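(* Let $P$ be a positive logic program with a finite set of clauses and with the bounded-term-size property, and let $G_0$ be a top goal. Then Algorithm 2 (the TP-resolution algorithm), applied to $P$ and $G_0$, terminates with a finite TP-tree $TP_{G_0}$.
   Context: **Conventions.** A (logic) program is a positive (definite) logic program with finitely many clauses. $p(\vec X)$ denotes an atom with predicate $p$ whose list of distinct variables is $\vec X$; $p(.)$ denotes any atom with predicate $p$. Atoms (subgoals, terms) are variants if they are equal up to variable renaming (so each is a variant of itself). Clauses with head predicate $p$ are numbered $C_{p_1},C_{p_2},\dots$ in program order. For a goal $G=\leftarrow A_1,\dots,A_m$, $G+B$ is $\leftarrow A_1,\dots,A_m,B$. Program clauses are standardized apart before use. $\vec X/\vec I$ is the substitution mapping $\vec X$ componentwise to $\vec I$. **Tabled predicates.** The dependency graph $G_P$ has an edge $p\to q$ whenever $P$ has a clause $p(.)\leftarrow\dots,q(.),\dots$. A predicate $p$ is tabled if $G_P$ contains a cycle through $p$; other predicates are non-tabled. An atom/subgoal is tabled if its predicate is. **Tables.** If $P$ has exactly $M$ clauses with head $p(.)$, a table $TB(p(\vec X))$ (shared by all variants of $p(\vec X)$) is a tuple $(p(\vec X),T,C,COMP)$: $T$ is a list of answer tuples (instances $\vec I$ of $\vec X$, representing answers $p(\vec X)\vec X/\vec I$; tuples are considered up to variable renaming); $C[i]=clause\_status[i]\in\{0,1\}$, with $1$ meaning $C_{p_i}$ is ''still available'' and $0$ ''no longer available''; $COMP\in\{0,1\}$. When a tabled subgoal occurs with no earlier variant, its table is created with $T$ empty, all $C[i]=1$,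 $COMP=0$. $NEW$ is a global flag. Operations: $memo(p(\vec X),\vec I)$: if $\vec I$ is not in the table, append it at the end, set $NEW=1$, and if $\vec I$ is a variant of $\vec X$ set $COMP=1$. $lookup(N_i,\vec I_i)$: fetch into $\vec I_i$ the next answer tuple of $TB(p(\vec X))$ via the pointer of $N_i$ (null if none). $memo\_look(N_i,p(\vec X),\vec I,\theta_i)$: perform $memo(p(\vec X),\vec I)$, then fetch for $N_i$ the next tuple $\vec F$ and set $\theta_i=\vec X/\vec F$ ($\theta_i=null$ if none). Substitutions applied to a $memo\_look$ subgoal act only on its third argument. $return(\vec Z)$ outputs $\vec Z$ (or YES if $\vec Z=()$). **Nodes.** Registering a node $N_i$ with $G_i=\leftarrow p(\vec X),A_2,\dots,A_m$ labels it with $G_i$ and creates: $answer\_ptr$ (into $TB(p(\vec X))$), $clause\_ptr$ (into the clauses for $p$), and flags $SUSP=0$, $node\_LOOP=0$, $node\_ITER=0$, $node\_ANC=-1$. Answers and clauses are taken top-down through these pointers, which advance with use. **Resolvents.** Let $N_i$ be labeled $G_i=\leftarrow A_1,\dots,A_m$, and let $A_k$ ($k>1$) be the left-most subgoal among $A_2,\dots,A_m$ of the form $memo\_look(.)$ (if none, take $k=m$). (1) If $A_1=memo\_look(N_h,p(\vec X),\vec I,\theta_h)$ with $\theta_h\ne null$: the resolvent of $G_i$ and $\theta_h$ is $\leftarrow(A_2,\dots,A_k)\theta_h,A_{k+1},\dots,A_m$. Let $C_p=A\leftarrow B_1,\dots,B_n$ with mgu $\theta$, $A\theta=A_1\theta$,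 $A_1=p(\vec X)$. (2) $A_1$ non-tabled: the resolvent of $G_i$ and $C_p$ is $\leftarrow(B_1,\dots,B_n,A_2,\dots,A_k)\theta,A_{k+1},\dots,A_m$. (3) $A_1$ tabled: the resolvent of $G_i$ and $C_p$ is $\leftarrow(B_1,\dots,B_n)\theta,memo\_look(N_i,p(\vec X),\vec X\theta,\theta_i),A_2,\dots,A_m$. (4) $A_1$ tabled and $\vec I\neq null$ an answer tuple of $TB(A_1)$: the resolvent of $G_i$ and $\vec I$ is $\leftarrow(A_2,\dots,A_k)\vec X/\vec I,A_{k+1},\dots,A_m$. **Ancestors and loops.** Each tabled subgoal $A$ at a node has an ancestor list $AL_A$: $AL_A=\{\}$ if $A$ is at the root; $AL_A=AL_{A'}$ if $A$ is inherited (copied or instantiated) from a subgoal $A'$ of the parent node; if $A$ comes from the body of a clause resolved with a subgoal $B$ at $N_f$, then $AL_A=AL_B\cup\{(N_f,B)\}$ if $B$ is tabled and $AL_A=\{\}$ otherwise. For left-most subgoals $A_i$ at $N_i$, $A_k$ at $N_k$, $A_i$ (resp. $N_i$) is an ancestor subgoal of $A_k$ (resp. ancestor node of $N_k$) if $(N_i,A_i)\in AL_{A_k}$. If moreover $A_i$ is a variant of $A_k$ (an ancestor variant subgoal), there is a loop $L(N_i,N_k)$. $nodetype\_update(L(N_1,N_m))$, for a loop whose nodes are $N_1,\dots,N_m$ ($N_1,\dots,N_{m-1}$ being the ancestor nodes of $N_m$ from $N_1$ on), where the left-most subgoal of $N_1$ is the closest ancestor variant subgoal of that of $N_m$ and is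 currently using clause $C_{p_j}$: (i) for $i>1$ set $N_i\to node\_LOOP=1$, $N_i\to node\_ITER=0$; (ii) if $N_1\to node\_LOOP=0$ set $N_1\to node\_LOOP=1$ and $N_1\to node\_ITER=1$; (iii) set $N_m\to node\_ANC=j$; (iv) for $i<m$ set $N_i\to SUSP=1$. **Algorithm 2.** Let $\vec Y$ be the list of variables of $G_0$. The TP-tree $TP_{G_0}$ of $P\cup\{G_0\}$ is built by performing the following steps until NO is returned. 1. (Root) Register the root $N_0$ with $G_0+return(\vec Y)$, set $NEW=0$, goto 2. 2. (Node expansion) Let $N_i$ be the latest registered node, labeled $G_i=\leftarrow A_1,\dots,A_m$ ($m>0$). Register $N_{i+1}$ as a child of $N_i$ with $G_{i+1}$ if $G_{i+1}$ is obtained as follows. - Case 1: $A_1=return(.)$. Execute it, set $G_{i+1}=\Box$, goto 3 with $N=N_i$. - Case 2: $A_1=memo\_look(N_h,p(\vec X),\vec I,\theta_h)$. Execute it. If $\theta_h=null$ goto 3 with $N=N_i$; else $G_{i+1}$ is the resolvent of $G_i$ and $\theta_h$; goto 2. - Case 3: $A_1$ non-tabled. Get the next clause $C$ whose head unifies with $A_1$. If none, goto 3 with $N=N_i$; else $G_{i+1}$ is the resolvent of $G_i$ and $C$; goto 2. - Case 4: $A_1=p(\vec X)$ tabled. Get the next answer tuple $\vec I$ from $TB(A_1)$. If $\vec I\ne null$, $G_{i+1}$ is the resolvent of $G_i$ and $\vec I$; goto 2. Otherwise if $TB(A_1)\to COMP=1$, goto 3 with $N=N_i$; else: - Case 4.1: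 $N_i\to node\_ANC=-1$. If $A_1$ has no ancestor variant subgoal, set $N_i\to node\_ANC=0$ and goto 4.2. Otherwise let $N_h$ be the closest ancestor node of $N_i$ such that $L(N_h,N_i)$ is a loop, call $nodetype\_update(L(N_h,N_i))$, goto 4.3. - Case 4.2: $N_i\to node\_ANC=0$. Get the next clause $C_{p_j}$ whose head unifies with $A_1$ with $TB(A_1)\to clause\_status[j]=1$. If it exists, $G_{i+1}$ is the resolvent of $G_i$ and $C_{p_j}$; goto 2. Otherwise, if $N_i\to node\_ITER=0$ goto 3 with $N=N_i$; else: (4.2.1) if $NEW=0$, set $TB(A_1)\to COMP=1$ and goto 3 with $N=N_i$; (4.2.2) if $NEW=1$, set $NEW=0$, reset $N_i\to clause\_ptr$ to the first clause $C_{p_j}$ whose status is still available, and goto 4.2. - Case 4.3: $N_i\to node\_ANC=j>0$. Get the next clause $C_{p_k}$, $k>j$, whose head unifies with $A_1$ with $TB(A_1)\to clause\_status[k]=1$. If it exists, $G_{i+1}$ is the resolvent of $G_i$ and $C_{p_k}$; goto 2; else goto 3 with $N=N_i$. 3. (Backtracking) If $N$ is the root, return NO. Otherwise let $N_f$ be the parent of $N$, with left-most subgoal $A_f$. - Case B1: $A_f$ is $memo\_look(.)$. Goto 3 with $N=N_f$. - Case B2: $A_f$ non-tabled. Goto 2 with $N_f$ as latest registered node. - Case B3: $A_f=q(\vec Z)$ tabled. If $N$ was generated from $N_f$ by resolving $A_f$ with a clause $C_{q_j}$: if $N_f\to SUSP=0$ set $TB(A_f)\to clause\_status[j]=0$,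 else set $N_f\to SUSP=0$. Goto 2 with $N_f$ as latest registered node. **Bounded-term-size property.** $P$ has this property if there is a function $f(n)$ such that whenever a top goal $G_0$ has no argument whose term size (number of symbol occurrences) exceeds $n$, no subgoal in the TP-tree $TP_{G_0}$ and no answer tuple in any table has an argument whose term size exceeds $f(n)$. *)

(* Defs.v *)
From mathcomp Require Import all_boot.
From mathcomp Require Import boolp classical_sets cardinality.

Set Implicit Arguments.
Unset Strict Implicit.
Unset Printing Implicit Defensive.

Local Open Scope classical_set_scope.

Section Logic.
Variables F Q : eqType.

(* As in Prolog, the same name used with different numbers of arguments denotes
   different symbols: [App f ts] is built with the function symbol
   [f / size ts], and the predicate of an atom is its name with its arity. *)
Inductive term := Var of nat | App of F & seq term.

Record atom := Atom { pname : Q; args : seq term }.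

Definition pred_of (A : atom) : Q * nat := (pname A, size (args A)).

Record clause := Clause { head : atom; body : seq atom }.

Definition program := seq clause.

Fixpoint tsize (t : term) : nat :=
  match t with
  | Var _ => 1
  | App _ ts => (sumn (map tsize ts)).+1
  end.

Fixpoint tvars (t : term) : seq nat :=
  match t with
  | Var x => [:: x]
  | App _ ts => flatten (map tvars ts)
  end.

Definition tuple_vars (ts : seq term) : seq nat := undup (flatten (map tvars ts)).

(* The list of distinct variables written X in p(X); [undup] keeps last
   occurrences, so variants list their variables in corresponding order. *)
Definition atom_vars (A : atom) : seq nat := tuple_vars (args A).

Definition clause_vars (C : clause) : seq nat :=
  atom_vars (head C) ++ flatten (map atom_vars (body C)).

Definition subst := nat -> term.

Fixpoint tsub (th : subst) (t : term) : term :=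
  match t with
  | Var x => th x
  | App f ts => App f (map (tsub th) ts)
  end.

Definition asub (th : subst) (A : atom) : atom :=
  Atom (pname A) (map (tsub th) (args A)).

Definition csub (th : subst) (C : clause) : clause :=
  Clause (asub th (head C)) (map (asub th) (body C)).

(* The substitution X/U; U, J are tuples of terms. *)
Definition bind (X : seq nat) (U : seq term) : subst :=
  fun x => nth (Var x) U (index x X).

Definition ren (r : nat -> nat) : subst := fun x => Var (r x).

Definition tuple_variant (U J : seq term) : Prop :=
  exists r : nat -> nat,
    {in tuple_vars U &, injective r} /\ map (tsub (ren r)) U = J.

Definition variant (A B : atom) : Prop :=
  pname A = pname B /\ tuple_variant (args A) (args B).

Definition clause_variant (C D : clause) : Prop :=
  exists r : nat -> nat,
    {in clause_vars C &, injective r} /\ csub (ren r) C = D.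

Definition unifier (th : subst) (A B : atom) : Prop := asub th A = asub th B.

Definition mgu (th : subst) (A B : atom) : Prop :=
  unifier th A B /\
  forall s : subst, unifier s A B ->
    exists d : subst, forall x, s x = tsub d (th x).

(* The edges of the dependency graph G_P. *)
Definition depends (P : program) (p q : Q * nat) : bool :=
  has (fun C => (pred_of (head C) == p) && (q \in map pred_of (body C))) P.

Definition tabled (P : program) (p : Q * nat) : Prop :=
  exists c : seq (Q * nat), path (depends P) p (rcons c p).

Definition clauses_of (P : program) (p : Q * nat) : seq clause :=
  [seq C <- P | pred_of (head C) == p].

(* C_{p_j}; clause numbers start from 1. *)
Definition clause_no (P : program) (p : Q * nat) (j : nat) : option clause :=
  if j is j'.+1 then onth (clauses_of P p) j' else None.

(* [Call A AL] is the subgoal A with its ancestor list AL (meaningful for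
   tabled A), closest ancestor first.
   [MemoLook h A U] is memo_look(N_h, A, U, theta_h): the output argument
   theta_h is determined when the subgoal is executed and is left out. *)
Inductive item :=
  | Call of atom & seq (nat * atom)
  | MemoLook of nat & atom & seq term
  | Return of seq term.

Definition goal := seq item.

Definition item_vars (x : item) : seq nat :=
  match x with
  | Call A _ => atom_vars A
  | MemoLook _ A U => atom_vars A ++ tuple_vars U
  | Return Z => tuple_vars Z
  end.

Definition goal_vars (G : goal) : seq nat := flatten (map item_vars G).

Definition isub (th : subst) (x : item) : item :=
  match x with
  | Call A AL => Call (asub th A) AL
  | MemoLook h A U => MemoLook h A (map (tsub th) U)
  | Return Z => Return (map (tsub th) Z)
  end.

(* Applies th up to and including the left-most memo_look. *)
Fixpoint gsub (th : subst) (G : goal) : goal :=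
  match G with
  | [::] => [::]
  | MemoLook h A U :: G' => isub th (MemoLook h A U) :: G'
  | x :: G' => isub th x :: gsub th G'
  end.

Definition calls (AL : seq (nat * atom)) (As : seq atom) : goal :=
  [seq Call A AL | A <- As].

(* t_goal is p(X); t_ans, t_status and t_comp are T, C and COMP; position
   j - 1 of t_status is clause_status[j]. *)
Record table := Table {
  t_goal : atom; t_ans : seq (seq term); t_status : seq bool; t_comp : bool }.

(* parent is None at the root.  via is the number of the clause from which the
   node was generated, None if it was generated otherwise.  answer_ptr is the
   number of answers already fetched and clause_ptr the number of the next
   clause to try.  The value -1 of node_ANC is None. *)
Record node := Node {
  parent : option nat; via : option nat; label : goal;
  answer_ptr : nat; clause_ptr : nat;
  SUSP : bool; node_LOOP : bool; node_ITER : bool; node_ANC : option nat }.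

(* Where the control is: expanding N_i as the latest registered node; looking
   for a clause at N_i once its ancestor variants have been determined (none:
   Goto42, some: Goto43); backtracking with N = N_i; NO has been returned. *)
Inductive control :=
  | Goto2 of nat | Goto42 of nat | Goto43 of nat | Goto3 of nat | ReturnedNO.

Record state := State {
  nodes : seq node; tables : seq table; NEW : bool;
  outputs : seq (seq term); ctrl : control }.

Definition set_answer_ptr k n :=
  Node (parent n) (via n) (label n) k (clause_ptr n)
       (SUSP n) (node_LOOP n) (node_ITER n) (node_ANC n).
Definition set_clause_ptr k n :=
  Node (parent n) (via n) (label n) (answer_ptr n) k
       (SUSP n) (node_LOOP n) (node_ITER n) (node_ANC n).
Definition set_SUSP b n :=
  Node (parent n) (via n) (label n) (answer_ptr n) (clause_ptr n)
       b (node_LOOP n) (node_ITER n) (node_ANC n).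
Definition set_LOOP_ITER b c n :=
  Node (parent n) (via n) (label n) (answer_ptr n) (clause_ptr n)
       (SUSP n) b c (node_ANC n).
Definition set_ANC a n :=
  Node (parent n) (via n) (label n) (answer_ptr n) (clause_ptr n)
       (SUSP n) (node_LOOP n) (node_ITER n) a.

Definition goto c s := State (nodes s) (tables s) (NEW s) (outputs s) c.
Definition set_nodes ns s := State ns (tables s) (NEW s) (outputs s) (ctrl s).
Definition set_tables ts s := State (nodes s) ts (NEW s) (outputs s) (ctrl s).
Definition set_NEW b s := State (nodes s) (tables s) b (outputs s) (ctrl s).
Definition output Z s :=
  State (nodes s) (tables s) (NEW s) (rcons (outputs s) Z) (ctrl s).

Fixpoint update T (f : T -> T) (i : nat) (l : seq T) : seq T :=
  match l, i with
  | [::], _ => [::]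
  | x :: l', 0 => f x :: l'
  | x :: l', i'.+1 => x :: update f i' l'
  end.

Definition upd_node (i : nat) (f : node -> node) (s : state) : state :=
  set_nodes (update f i (nodes s)) s.

(* TB(A) is found up to variants. *)
Definition table_idx (s : state) (A : atom) : nat :=
  find (fun tb => `[< variant A (t_goal tb) >]) (tables s).

Definition table_of (s : state) (A : atom) : option table :=
  onth (tables s) (table_idx s A).

Definition upd_table (A : atom) (f : table -> table) (s : state) : state :=
  set_tables (update f (table_idx s A) (tables s)) s.

Definition add_answer U tb :=
  Table (t_goal tb) (rcons (t_ans tb) U) (t_status tb) (t_comp tb).
Definition set_comp tb := Table (t_goal tb) (t_ans tb) (t_status tb) true.
Definition close_clause j tb :=
  Table (t_goal tb) (t_ans tb) (update (fun=> false) j.-1 (t_status tb))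
        (t_comp tb).

Definition comp (s : state) (A : atom) : bool :=
  if table_of s A is Some tb then t_comp tb else false.

Definition available (s : state) (A : atom) (j : nat) : bool :=
  if table_of s A is Some tb then (0 < j) && nth false (t_status tb) j.-1
  else false.

Definition first_available (s : state) (A : atom) : nat :=
  if table_of s A is Some tb then (find id (t_status tb)).+1 else 1.

Definition memo (A : atom) (U : seq term) (s : state) : state :=
  if table_of s A is Some tb then
    if has (fun J => `[< tuple_variant U J >]) (t_ans tb) then s
    else
      let s' := set_NEW true (upd_table A (add_answer U) s) in
      if `[< tuple_variant U (map Var (atom_vars A)) >]
      then upd_table A set_comp s' else s'
  else s.

(* The next answer of TB(A) for node h, None for null; [advance] moves the
   pointer past it. *)
Definition lookup (s : state) (h : nat) (A : atom) : option (seq term) :=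
  match onth (nodes s) h, table_of s A with
  | Some nd, Some tb => onth (t_ans tb) (answer_ptr nd)
  | _, _ => None
  end.

Definition advance (h : nat) (s : state) : state :=
  upd_node h (fun nd => set_answer_ptr (answer_ptr nd).+1 nd) s.

(* The table of a tabled subgoal is created when the subgoal first becomes
   left-most, before which the table is never consulted. *)
Definition create_table (P : program) (G : goal) (s : state) : state :=
  match G with
  | Call A _ :: _ =>
      if `[< tabled P (pred_of A) >] && ~~ table_of s A
      then set_tables
             (rcons (tables s)
                (Table A [::] (nseq (size (clauses_of P (pred_of A))) true) false)) s
      else s
  | _ => s
  end.

Definition register (P : program) (par v : option nat) (G : goal) (s : state) :=
  create_table P G
    (set_nodes (rcons (nodes s) (Node par v G 0 1 false false false None)) s).

Definition register_child (P : program) (i : nat) (v : option nat) (G : goal)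
    (s : state) : state :=
  goto (Goto2 (size (nodes s))) (register P (Some i) v G s).

Definition init (P : program) (G0 : seq atom) : state :=
  register P None None
    (calls [::] G0 ++
     [:: Return (map Var (undup (flatten (map atom_vars G0))))])
    (State [::] [::] false [::] (Goto2 0)).

(* No variable of xs occurs in the part of the tree built so far. *)
Definition fresh (s : state) (xs : seq nat) : Prop :=
  ~~ has (mem (flatten (map (goal_vars \o label) (nodes s)))) xs.

Definition fresh_clause (s : state) (C C' : clause) : Prop :=
  clause_variant C C' /\ fresh s (clause_vars C').

Definition fresh_tuple (s : state) (U U' : seq term) : Prop :=
  tuple_variant U U' /\ fresh s (tuple_vars U').

Definition candidate (P : program) (s : state) (nd : node) (A : atom)
    (ok : nat -> bool) (j : nat) : Prop :=
  [/\ clause_ptr nd <= j, ok j &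
    exists C C' th, [/\ clause_no P (pred_of A) j = Some C,
                        fresh_clause s C C' & unifier th (head C') A]].

(* C_{p_j} is the next clause, from clause_ptr on, whose head unifies with A
   and whose number satisfies ok. *)
Definition next_clause P s nd A ok (j : nat) : Prop :=
  candidate P s nd A ok j /\ forall k, k < j -> ~ candidate P s nd A ok k.

Definition no_clause P s nd A ok : Prop := forall k, ~ candidate P s nd A ok k.

Definition instance_of P s A j (C' : clause) (th : subst) : Prop :=
  exists C, [/\ clause_no P (pred_of A) j = Some C,
                fresh_clause s C C' & mgu th (head C') A].

Definition use_clause (i j : nat) (s : state) : state :=
  upd_node i (set_clause_ptr j.+1) s.

(* The resolvent of <- A, G' at N_i with a clause, A tabled. *)
Definition tabled_resolvent (i : nat) (A : atom) (AL : seq (nat * atom))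
    (G' : goal) (C' : clause) (th : subst) : goal :=
  map (isub th) (calls ((i, A) :: AL) (body C')) ++
  MemoLook i A (map (tsub th) (map Var (atom_vars A))) :: G'.

Definition anc_variant (A : atom) (x : nat * atom) : bool :=
  `[< variant x.2 A >].

(* The loop L(N_h, N_i), mid being the ancestor nodes strictly between. The
   clause being used by N_h is the last one fetched there. *)
Definition nodetype_update (h : nat) (mid : seq nat) (i : nat) (s : state) : state :=
  let s1 := foldr (fun k => upd_node k (set_LOOP_ITER true false)) s (rcons mid i) in
  let s2 := upd_node h
    (fun nd => if node_LOOP nd then nd else set_LOOP_ITER true true nd) s1 in
  let j := if onth (nodes s) h is Some nd then (clause_ptr nd).-1 else 0 in
  let s3 := upd_node i (set_ANC (Some j)) s2 in
  foldr (fun k => upd_node k (set_SUSP true)) s3 (h :: mid).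

Definition at_node (s : state) (c : nat -> control) (i : nat) (nd : node)
    (x : item) (G' : goal) : Prop :=
  [/\ ctrl s = c i, onth (nodes s) i = Some nd & label nd = x :: G'].

(* A node with a tabled left-most subgoal that has no further answer and whose table is incomplete. *)
Definition at_case4 P s i nd A AL G' : Prop :=
  [/\ at_node s Goto2 i nd (Call A AL) G', tabled P (pred_of A),
      lookup s i A = None & ~~ comp s A].

Definition backtrack (s : state) (i f : nat) (nd nf : node) : Prop :=
  [/\ ctrl s = Goto3 i, onth (nodes s) i = Some nd, parent nd = Some f &
      onth (nodes s) f = Some nf].

(* One step of the algorithm.  It is deterministic but for the choice of the
   fresh variables and of the most general unifiers. *)
Inductive step (P : program) (s : state) : state -> Prop :=
  | Case1 i nd Z G' :
      at_node s Goto2 i nd (Return Z) G' ->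
      step P s (goto (Goto3 i) (register_child P i None [::] (output Z s)))
  | Case2_null i nd h A U G' :
      at_node s Goto2 i nd (MemoLook h A U) G' ->
      lookup (memo A U s) h A = None ->
      step P s (goto (Goto3 i) (memo A U s))
  | Case2_answer i nd h A U G' J J' :
      at_node s Goto2 i nd (MemoLook h A U) G' ->
      lookup (memo A U s) h A = Some J -> fresh_tuple s J J' ->
      step P s (register_child P i None (gsub (bind (atom_vars A) J') G')
                  (advance h (memo A U s)))
  | Case3_clause i nd A AL G' j C' th :
      at_node s Goto2 i nd (Call A AL) G' -> ~ tabled P (pred_of A) ->
      next_clause P s nd A predT j -> instance_of P s A j C' th ->
      step P s (register_child P i (Some j)
                  (gsub th (calls [::] (body C') ++ G')) (use_clause i j s))
  | Case3_none i nd A AL G' :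
      at_node s Goto2 i nd (Call A AL) G' -> ~ tabled P (pred_of A) ->
      no_clause P s nd A predT ->
      step P s (goto (Goto3 i) s)
  | Case4_answer i nd A AL G' J J' :
      at_node s Goto2 i nd (Call A AL) G' -> tabled P (pred_of A) ->
      lookup s i A = Some J -> fresh_tuple s J J' ->
      step P s (register_child P i None (gsub (bind (atom_vars A) J') G')
                  (advance i s))
  | Case4_complete i nd A AL G' :
      at_node s Goto2 i nd (Call A AL) G' -> tabled P (pred_of A) ->
      lookup s i A = None -> comp s A ->
      step P s (goto (Goto3 i) s)
  | Case41_first i nd A AL G' :
      at_case4 P s i nd A AL G' -> node_ANC nd = None ->
      ~~ has (anc_variant A) AL ->
      step P s (goto (Goto42 i) (upd_node i (set_ANC (Some 0)) s))
  | Case41_loop i nd A AL1 h B AL2 G' :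
      at_case4 P s i nd A (AL1 ++ (h, B) :: AL2) G' -> node_ANC nd = None ->
      ~~ has (anc_variant A) AL1 -> anc_variant A (h, B) ->
      step P s (goto (Goto43 i) (nodetype_update h (map fst AL1) i s))
  | Case4_to_42 i nd A AL G' :
      at_case4 P s i nd A AL G' -> node_ANC nd = Some 0 ->
      step P s (goto (Goto42 i) s)
  | Case4_to_43 i nd A AL G' j :
      at_case4 P s i nd A AL G' -> node_ANC nd = Some j.+1 ->
      step P s (goto (Goto43 i) s)
  | Case42_clause i nd A AL G' j C' th :
      at_node s Goto42 i nd (Call A AL) G' ->
      next_clause P s nd A (available s A) j -> instance_of P s A j C' th ->
      step P s (register_child P i (Some j) (tabled_resolvent i A AL G' C' th)
                  (use_clause i j s))
  | Case42_no_iter i nd A AL G' :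
      at_node s Goto42 i nd (Call A AL) G' ->
      no_clause P s nd A (available s A) -> ~~ node_ITER nd ->
      step P s (goto (Goto3 i) s)
  | Case421 i nd A AL G' :
      at_node s Goto42 i nd (Call A AL) G' ->
      no_clause P s nd A (available s A) -> node_ITER nd -> ~~ NEW s ->
      step P s (goto (Goto3 i) (upd_table A set_comp s))
  | Case422 i nd A AL G' :
      at_node s Goto42 i nd (Call A AL) G' ->
      no_clause P s nd A (available s A) -> node_ITER nd -> NEW s ->
      step P s (set_NEW false
                  (upd_node i (set_clause_ptr (first_available s A)) s))
  | Case43_clause i nd A AL G' j k C' th :
      at_node s Goto43 i nd (Call A AL) G' -> node_ANC nd = Some j ->
      next_clause P s nd A (fun k => (j < k) && available s A k) k ->
      instance_of P s A k C' th ->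
      step P s (register_child P i (Some k) (tabled_resolvent i A AL G' C' th)
                  (use_clause i k s))
  | Case43_none i nd A AL G' j :
      at_node s Goto43 i nd (Call A AL) G' -> node_ANC nd = Some j ->
      no_clause P s nd A (fun k => (j < k) && available s A k) ->
      step P s (goto (Goto3 i) s)
  | Back_root i nd :
      ctrl s = Goto3 i -> onth (nodes s) i = Some nd -> parent nd = None ->
      step P s (goto ReturnedNO s)
  | CaseB1 i f nd nf h A U G' :
      backtrack s i f nd nf -> label nf = MemoLook h A U :: G' ->
      step P s (goto (Goto3 f) s)
  | CaseB2 i f nd nf A AL G' :
      backtrack s i f nd nf -> label nf = Call A AL :: G' ->
      ~ tabled P (pred_of A) ->
      step P s (goto (Goto2 f) s)
  | CaseB3_answer i f nd nf A AL G' :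
      backtrack s i f nd nf -> label nf = Call A AL :: G' ->
      tabled P (pred_of A) -> via nd = None ->
      step P s (goto (Goto2 f) s)
  | CaseB3_clause i f nd nf A AL G' j :
      backtrack s i f nd nf -> label nf = Call A AL :: G' ->
      tabled P (pred_of A) -> via nd = Some j -> ~~ SUSP nf ->
      step P s (goto (Goto2 f) (upd_table A (close_clause j) s))
  | CaseB3_susp i f nd nf A AL G' j :
      backtrack s i f nd nf -> label nf = Call A AL :: G' ->
      tabled P (pred_of A) -> via nd = Some j -> SUSP nf ->
      step P s (goto (Goto2 f) (upd_node f (set_SUSP false) s)).

(* An execution, in which a state without successor is repeated forever: this
   happens after NO has been returned, and would also happen if the algorithm
   were stuck. *)
Definition execution (P : program) (G0 : seq atom) (r : nat -> state) : Prop :=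
  r 0 = init P G0 /\
  forall n, step P (r n) (r n.+1) \/
            (r n.+1 = r n /\ forall s, ~ step P (r n) s).

Lemma execution_exists (P : program) (G0 : seq atom) :
  exists r, execution P G0 r.
Proof.
have next s : exists s', step P s s' \/ (s' = s /\ forall s'', ~ step P s s'').
  have [[s' h]|h] := pselect (exists s', step P s s'); first by exists s'; left.
  by exists s; right; split=> // s'' h'; apply: h; exists s''.
have [f hf] := choice next.
by exists (fun n => iter n f (init P G0)); split=> // n; apply: hf.
Qed.

(* The tree, possibly infinite, of all the nodes registered in an execution:
   a node is given by its number, the number of its parent and its label. *)
Definition TP_tree (r : nat -> state) : set (nat * option nat * goal) :=
  [set N | exists n nd, onth (nodes (r n)) N.1.1 = Some nd /\
                        N = (N.1.1, parent nd, label nd)].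

Definition tuple_bounded (b : nat) (ts : seq term) : bool :=
  all (fun t => tsize t <= b) ts.

Definition subgoals_bounded (b : nat) (G : goal) : bool :=
  all (fun x => if x is Call A _ then tuple_bounded b (args A) else true) G.

Definition bounded_term_size (P : program) : Prop :=
  exists f : nat -> nat, forall (n : nat) (G0 : seq atom) (r : nat -> state),
    all (fun A => tuple_bounded n (args A)) G0 -> execution P G0 r ->
    (forall N, TP_tree r N -> subgoals_bounded (f n) N.2) /\
    (forall m, all (fun tb => all (tuple_bounded (f n)) (t_ans tb))
                   (tables (r m))).

End Logic.

(* Main.v *)
(* A lexicographic measure decreases at every step.  Its components, by
   decreasing priority, are:
   - the number of answers that can still enter the tables (finite, since term
     sizes are bounded and answers are kept up to variants), doubled, plus NEW;
     Case 4.2.2, which restarts the clauses of a node, consumes NEW;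
   - the sum over the nodes of the number of moves their answer and clause
     pointers still allow, weighted by an exponential in the weight of the label,
     so that one move of a pointer pays for the child that it creates;
   - the position of the control: without registering a node, it only goes up.
   The weight of labels must decrease from parent to child.  A call of a
   non-tabled predicate decreases the rank in the dependency graph.  A call of a
   tabled one lengthens the ancestor list, whose length is bounded: by Case 4.3,
   variants in an ancestor list use strictly increasing clause numbers.
   Finally the algorithm is never stuck, because unifiable atoms have a most
   general unifier. *)

Require Import Defs.
From HB Require Import structures.
From mathcomp Require Import all_boot.
From mathcomp Require Import boolp classical_sets cardinality.
From mathcomp Require Import zify.
(* MathComp has its own [tsize], [head], [comp], ...: those of Defs must win. *)
Import Defs.

Set Implicit Arguments.
Unset Strict Implicit.
Unset Printing Implicit Defensive.

(** Bounded term size alone leaves infinitely many answers: [F] may be infinite, variables are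
    unlimited, and the unifiers are arbitrary most general ones, not the output of a fixed
    procedure. But every most general unifier of atoms over a set of symbols stays over that set,
    and canonical renaming removes the choice of variables, so a finite list represents all answers
    up to variants. The bound on ancestor lists meets a mismatch: Case 4.3 compares with the clause
    that the ancestor fetched last, whereas the argument needs the clause through which the branch
    leaves that ancestor. The two are known to agree on the current branch only, so this invariant
    is attached to the control and not to the tree. A [memo_look] creates a child by moving the
    answer pointer of N_h, not that of its own node. The payment still works because the label of
    N_h is heavier. Size bounds are available only for states that an execution reaches, hence the
    step lemma takes them both before and after the step. *)

HB.instance Definition _ (F : eqType) := gen_eqMixin (term F).
HB.instance Definition _ (F Q : eqType) := gen_eqMixin (atom F Q).
HB.instance Definition _ (F Q : eqType) := gen_eqMixin (clause F Q).
HB.instance Definition _ (F Q : eqType) := gen_eqMixin (item F Q).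

(** * First-order terms: substitutions, variables, sizes *)

Section Terms.
Variable F : eqType.
Implicit Types (t u : term F) (ts us U J : seq (term F)) (s th d : subst F).

Lemma tsize_arg t ts : t \in ts -> tsize t <= sumn (map (@tsize F) ts).
Proof. by move=> t_ts; rewrite sumnE big_map (big_rem t) //= leq_addr. Qed.

(** The generated principle says nothing about arguments nested in a list; induction on the size
    recovers them. *)
Lemma term_nested_ind (K : term F -> Prop) :
  (forall x, K (Var F x)) ->
  (forall f ts, {in ts, forall t, K t} -> K (App f ts)) ->
  forall t, K t.
Proof.
move=> KV KA t; have [n lt_n] := ubnP (tsize t).
elim: n t lt_n => // n IH [x|f ts] /= lt_n; first exact: KV.
by apply: KA => t /tsize_arg le_t; apply: IH; apply: leq_ltn_trans le_t _.
Qed.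

Lemma tsize_gt0 t : 0 < tsize t.
Proof. by case: t. Qed.

Lemma tsub_comp s th t : tsub s (tsub th t) = tsub (tsub s \o th) t.
Proof.
elim/term_nested_ind: t => [//|f ts IH] /=; congr App; rewrite -map_comp.
by apply/eq_in_map => u /IH.
Qed.

Lemma tsub_eq_in s s' t : {in tvars t, s =1 s'} -> tsub s t = tsub s' t.
Proof.
elim/term_nested_ind: t => [x|f ts IH] /= H; first by apply: H; rewrite inE.
congr App; apply/eq_in_map => u u_ts; apply: IH => // x xu.
by apply: H; apply/flattenP; exists (tvars u); rewrite ?map_f.
Qed.

Lemma tsub_Var t : tsub (@Var F) t = t.
Proof.
elim/term_nested_ind: t => [//|f ts IH] /=; congr App.
by rewrite -[RHS]map_id; apply/eq_in_map => u /IH.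
Qed.

Lemma tvars_sub s t :
  tvars (tsub s t) = flatten [seq tvars (s x) | x <- tvars t].
Proof.
elim/term_nested_ind: t => [x|f ts IH] /=; first by rewrite cats0.
rewrite -map_comp; elim: ts IH => [//|u ts IHts] IH /=.
rewrite IH ?mem_head // map_cat flatten_cat IHts // => v v_ts.
by apply: IH; rewrite inE v_ts orbT.
Qed.

Lemma tvars_ren r t : tvars (tsub (ren F r) t) = map r (tvars t).
Proof. by rewrite tvars_sub /=; elim: (tvars t) => //= x l ->. Qed.

Lemma tsize_var_le s t x : x \in tvars t -> tsize (s x) <= tsize (tsub s t).
Proof.
elim/term_nested_ind: t => [y|f ts IH] /=; first by rewrite inE => /eqP->.
case/flattenP=> _ /mapP[u u_ts ->] /(IH _ u_ts) le_u.
apply: leq_trans le_u _; apply: leqW.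
exact: tsize_arg (map_f _ u_ts).
Qed.

Lemma tsize_var_lt s f ts x :
  x \in tvars (App f ts) -> tsize (s x) < tsize (tsub s (App f ts)).
Proof.
case/flattenP=> _ /mapP[u u_ts ->] /(tsize_var_le s) le_u /=.
rewrite ltnS; apply: leq_trans le_u _.
exact: tsize_arg (map_f _ u_ts).
Qed.

Lemma size_tvars t : size (tvars t) <= tsize t.
Proof.
elim/term_nested_ind: t => [//|f ts IH] /=; apply: leqW.
rewrite size_flatten /shape -map_comp !sumnE !big_map big_seq [leqRHS]big_seq.
exact: leq_sum.
Qed.

Lemma size_tuple_vars b ts :
  tuple_bounded b ts -> size (tuple_vars ts) <= size ts * b.
Proof.
move=> bts; apply: leq_trans (size_undup _) _.
elim: ts bts => [//|t ts IH] /= /andP[bt /IH le_ts].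
by rewrite size_cat mulSn leq_add // (leq_trans (size_tvars t)).
Qed.

(** * Unification *)

Definition unifies s (E : seq (term F * term F)) :=
  all (fun e => tsub s e.1 == tsub s e.2) E.

Definition eqns_vars (E : seq (term F * term F)) :=
  undup (flatten [seq tvars e.1 ++ tvars e.2 | e <- E]).

Definition eqns_size (E : seq (term F * term F)) :=
  sumn [seq tsize e.1 + tsize e.2 | e <- E].

(* The equation [s =1 tsub s \o th] says that [th] is most general and
   idempotent; it composes better than the existence of some factor. *)
Definition solvable (E : seq (term F * term F)) :=
  (exists s, unifies s E) ->
  exists th, unifies th E /\
    forall s, unifies s E -> forall x, s x = tsub s (th x).

Definition single (x : nat) t : subst F :=
  fun y => if y == x then t else Var F y.

Lemma mem_eqns_vars E x :
  (x \in eqns_vars E) = has (fun e => (x \in tvars e.1) || (x \in tvars e.2)) E.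
Proof.
rewrite mem_undup; elim: E => //= e E IH.
by rewrite !mem_cat IH.
Qed.

Lemma tvars_single x t u y : x \notin tvars t ->
  y \in tvars (tsub (single x t) u) ->
  y != x /\ ((y \in tvars t) || (y \in tvars u)).
Proof.
move=> xt; rewrite tvars_sub => /flattenP[_ /mapP[z zu ->]].
rewrite /single; have [_|zx] := eqVneq z x.
  by move=> yt; rewrite yt; split=> //; apply: contraNneq xt => <-.
by rewrite inE => /eqP->; split; rewrite ?zu ?orbT.
Qed.

(** Variable elimination: replacing [x] by [t] yields a system without [x], and a most general
    solution of it, composed after [single x t], solves the original one. *)
Lemma solvable_elim x t E :
  (forall E', size (eqns_vars E') < size (eqns_vars ((Var F x, t) :: E)) ->
     solvable E') ->
  t != Var F x -> solvable ((Var F x, t) :: E).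
Proof.
move=> IH t_x [s0 s0E].
(* Occurs check: under the unifier [s0], a proper occurrence of [x] in [t] would make [s0 x] larger
   than itself. *)
have xt : x \notin tvars t.
  apply/negP => xt; move: s0E => /= /andP[/eqP s0x _].
  case: t t_x xt s0x {IH} => [y|f ts] t_x xt s0x.
    by move: xt t_x; rewrite inE => /eqP->; rewrite eqxx.
  by have := tsize_var_lt s0 xt; rewrite s0x ltnn.
pose sg := single x t.
pose E' := [seq (tsub sg e.1, tsub sg e.2) | e <- E].
have sgE s : s x = tsub s t -> forall u, tsub s (tsub sg u) = tsub s u.
  move=> sx u; rewrite tsub_comp; apply: tsub_eq_in => y _ /=.
  by rewrite /sg /single; have [->|] := eqVneq y x.
have unifE' s : unifies s ((Var F x, t) :: E) -> s x = tsub s t /\ unifies s E'.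
  move=> /= /andP[/eqP sx sE]; split=> //; rewrite /E' /unifies all_map.
  by apply: sub_all sE => e /eqP e12; rewrite /= !sgE // e12.
have lt_E' : size (eqns_vars E') < size (eqns_vars ((Var F x, t) :: E)).
  rewrite -[(size _).+1]/(size (x :: eqns_vars E')); apply: uniq_leq_size.
    rewrite /= undup_uniq andbT; apply/negP; rewrite mem_eqns_vars => /hasP[e'].
    case/mapP=> e eE -> /=.
    by case/orP=> /(tvars_single xt)[]; rewrite eqxx.
  move=> y; rewrite inE => /orP[/eqP->|]; rewrite !mem_eqns_vars /= inE.
    by rewrite eqxx.
  case/hasP=> _ /mapP[e eE ->] /= ye.
  have : (y \in tvars t) || (y \in tvars e.1) || (y \in tvars e.2).
    by case/orP: ye => /(tvars_single xt)[_] /orP[]->; rewrite ?orbT.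
  rewrite -orbA => /orP[->|ye']; first by rewrite orbT.
  by apply/orP; right; apply/hasP; exists e.
have [th [thE' th_mg]] := IH E' lt_E' (ex_intro _ s0 (unifE' s0 s0E).2).
exists (tsub th \o sg); split.
  apply/andP; split.
    rewrite /= -tsub_comp {1}/sg /single eqxx; apply/eqP; congr tsub.
    rewrite -[LHS]tsub_Var; apply: tsub_eq_in => y yt.
    by rewrite /sg /single; case: eqVneq => // yx; move: xt; rewrite -yx yt.
  rewrite /unifies all_map in thE'; apply: sub_all thE' => e /=.
  by rewrite !tsub_comp.
move=> s /unifE'[sx sE'] y /=.
rewrite tsub_comp (tsub_eq_in (s' := s)) => [|z _ /=]; last by rewrite -th_mg.
exact: esym (sgE s sx (Var F y)).
Qed.

Lemma solvable_swap t u E : solvable ((u, t) :: E) -> solvable ((t, u) :: E).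
Proof.
have swapE s : unifies s ((u, t) :: E) = unifies s ((t, u) :: E).
  by rewrite /unifies /= eq_sym.
move=> H [s0 s0E]; have [|th [thE mg]] := H; first by exists s0; rewrite swapE.
by exists th; split=> [|s]; rewrite -swapE // => /mg.
Qed.

Lemma unifies_zip s f ts us E :
  size ts = size us ->
  unifies s ((App f ts, App f us) :: E) = unifies s (zip ts us ++ E).
Proof.
rewrite /unifies all_cat /= => sz; congr andb.
have -> : (App f (map (tsub s) ts) == App f (map (tsub s) us)) =
          (map (tsub s) ts == map (tsub s) us).
  by apply/eqP/eqP => [[]|->].
elim: ts us sz => [|t ts IH] [|u us] //= [/IH <-].
by rewrite eqseq_cons.
Qed.

(** Lexicographic induction on the number of variables, then on the total size. Elimination lowers
    the former; deleting a trivial equation or decomposing one lowers the latter without adding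
    variables. *)
Lemma solvable_all E : solvable E.
Proof.
have [n le_n] := ubnP (size (eqns_vars E)).
elim: n E le_n => // n IHn E le_n.
have [m le_m] := ubnP (eqns_size E).
elim: m E le_m le_n => // m IHm [|[t u] E] le_m le_n.
  by move=> _; exists (@Var F); split.
have elimx x v E' : size (eqns_vars ((Var F x, v) :: E')) < n.+1 ->
    v != Var F x -> solvable ((Var F x, v) :: E').
  by move=> le_v; apply: solvable_elim => E'' lt_E''; apply: IHn; lia.
case: (eqVneq t u) => [tu|tu].
  case=> s0 /andP[_ s0E].
  have mE : eqns_size E < m.
    by move: le_m; rewrite /eqns_size /=; have := tsize_gt0 t; lia.
  have vE : size (eqns_vars E) < n.+1.
    apply: leq_ltn_trans le_n; apply: uniq_leq_size; first exact: undup_uniq.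
    by move=> x; rewrite !mem_eqns_vars /= => ->; rewrite orbT.
  have [th [thE mg]] := IHm E mE vE (ex_intro _ s0 s0E).
  exists th; split; first by rewrite tu /= eqxx.
  by move=> s; rewrite tu /= => /andP[_ /mg].
case: t u tu le_m le_n => [x|f ts] [y|g us] tu le_m le_n.
- by apply: elimx; rewrite // eq_sym.
- by apply: elimx; rewrite // eq_sym.
- apply: solvable_swap; apply: elimx => //.
  apply: leq_ltn_trans le_n; apply: uniq_leq_size; first exact: undup_uniq.
  by move=> z; rewrite !mem_eqns_vars /= [(z \in _) || (z \in _)]orbC.
- case=> s0 s0E.
  have [fg sz] : f = g /\ size ts = size us.
    move: s0E => /= /andP[/eqP[-> /(congr1 size)]].
    by rewrite !size_map.
  subst g; have := unifies_zip _ f E sz => zipE.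
  have vE : size (eqns_vars (zip ts us ++ E)) < n.+1.
    apply: leq_ltn_trans le_n; apply: uniq_leq_size; first exact: undup_uniq.
    move=> x; rewrite !mem_eqns_vars has_cat /= => /orP[|->]; last by rewrite orbT.
    case/hasP=> -[t u] tu_in /= xtu.
    have t_ts : t \in ts by rewrite -(unzip1_zip (eq_leq sz)); apply: (map_f fst tu_in).
    have u_us : u \in us by rewrite -(@unzip2_zip _ _ ts us) ?sz //; apply: (map_f snd tu_in).
    rewrite -orbA; case/orP: xtu => xt; apply/orP; [left|right; apply/orP; left].
      by apply/flattenP; exists (tvars t); rewrite ?map_f.
    by apply/flattenP; exists (tvars u); rewrite ?map_f.
  have mE : eqns_size (zip ts us ++ E) < m.
    apply: leq_trans (_ : eqns_size ((App f ts, App f us) :: E) <= m); last exact: le_m.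
    rewrite /eqns_size map_cat sumn_cat /= ltn_add2r.
    rewrite addSn ltnS addnS; apply: leqW.
    elim: ts us sz {s0E zipE tu le_m le_n vE} => [|t ts IH] [|u us] //= [/IH]; lia.
  have [th [thE mg]] := IHm _ mE vE (ex_intro _ s0 (etrans (esym (zipE s0)) s0E)).
  by exists th; split=> [|s]; rewrite zipE // => /mg.
Qed.

(** * Variants *)

Fixpoint term_over (Fs : seq F) t : bool :=
  match t with
  | Var _ => true
  | App f ts => (f \in Fs) && all (term_over Fs) ts
  end.

Fixpoint symbols t : seq F :=
  match t with
  | Var _ => [::]
  | App f ts => f :: flatten [seq symbols u | u <- ts]
  end.

Lemma over_symbols Fs t : {subset symbols t <= Fs} -> term_over Fs t.
Proof.
elim/term_nested_ind: t => [//|f ts IH] /= sub; rewrite sub ?mem_head //=.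
apply/allP => u u_ts; apply: IH => // g gu; apply: sub; rewrite inE.
by apply/orP; right; apply/flattenP; exists (symbols u); rewrite ?map_f.
Qed.

Lemma over_tsub Fs s t :
  (forall x, term_over Fs (s x)) -> term_over Fs t -> term_over Fs (tsub s t).
Proof.
move=> sF; elim/term_nested_ind: t => [x _|f ts IH] /=; first exact: sF.
move=> /andP[-> /allP ts_F] /=.
by rewrite all_map; apply/allP => u u_ts; apply: IH => //; apply: ts_F.
Qed.

Lemma over_of_tsub Fs s t : term_over Fs (tsub s t) -> term_over Fs t.
Proof.
elim/term_nested_ind: t => [//|f ts IH] /= /andP[-> /allP ts_F] /=.
by apply/allP => u u_ts; apply: IH => //; apply: ts_F; apply: map_f.
Qed.

Lemma over_ren Fs r t : term_over Fs (tsub (ren F r) t) = term_over Fs t.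
Proof. by apply/idP/idP => [/over_of_tsub|] //; apply: over_tsub. Qed.

(** Cuts a term at each symbol outside [Fs]; the variable 0 put there is arbitrary. Composing a
    unifier of atoms over [Fs] with it gives another unifier, free of foreign symbols. *)
Fixpoint erase (Fs : seq F) t : term F :=
  match t with
  | Var x => Var F x
  | App f ts => if f \in Fs then App f (map (erase Fs) ts) else Var F 0
  end.

Lemma over_erase Fs t : term_over Fs (erase Fs t).
Proof.
elim/term_nested_ind: t => [//|f ts IH] /=; case: ifP => //= ->.
by rewrite all_map; apply/allP => u /IH.
Qed.

Lemma erase_tsub Fs s t :
  term_over Fs t -> erase Fs (tsub s t) = tsub (erase Fs \o s) t.
Proof.
elim/term_nested_ind: t => [//|f ts IH] /= /andP[-> /allP ts_F].
congr App; rewrite -map_comp; apply/eq_in_map => u u_ts; apply: IH => //.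
exact: ts_F.
Qed.

Lemma tsize_ren r t : tsize (tsub (ren F r) t) = tsize t.
Proof.
elim/term_nested_ind: t => [//|f ts IH] /=; congr (sumn _).+1.
by rewrite -map_comp; apply/eq_in_map => u /IH.
Qed.

Lemma tuple_vars_ren r U :
  {in tuple_vars U &, injective r} ->
  tuple_vars (map (tsub (ren F r)) U) = map r (tuple_vars U).
Proof.
rewrite /tuple_vars -map_comp (eq_map (tvars_ren r)).
rewrite (map_comp (map r)) -map_flatten.
elim: (flatten _) => //= x l IH inj_r.
have sub_l : {subset undup l <= if x \in l then undup l else x :: undup l}.
  by move=> y yl; case: ifP; rewrite // inE yl orbT.
rewrite IH => [|y z yl zl]; last by apply: inj_r; exact: sub_l.
have -> : (r x \in map r l) = (x \in l).
  apply/mapP/idP => [[y yl rxy]|]; last by exists x.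
  suff -> : x = y by [].
  case: ifP inj_r => [xl|xl] inj_r; last first.
    by apply: inj_r => //; rewrite inE ?eqxx // mem_undup yl orbT.
  by apply: inj_r => //; rewrite mem_undup.
by case: ifP.
Qed.

(* A representative of the variants of U, with variables 0, 1, ... *)
Definition canon_tuple U : seq (term F) :=
  map (tsub (ren F (index^~ (tuple_vars U)))) U.

Lemma index_inj (V : seq nat) : {in V &, injective (index^~ V)}.
Proof. by move=> x y xV yV /= e; rewrite -(nth_index 0 xV) e nth_index. Qed.

Lemma index_map_in (r : nat -> nat) V x :
  {in V &, injective r} -> x \in V -> index (r x) (map r V) = index x V.
Proof.
elim: V => //= y V IH inj_r; rewrite inE => /predU1P[->|xV]; first by rewrite !eqxx.
have -> : (r y == r x) = (y == x).
  by apply/eqP/eqP => [|-> //]; apply: inj_r; rewrite inE ?eqxx ?xV ?orbT.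
rewrite IH // => a b aV bV; apply: inj_r; rewrite inE ?aV ?bV orbT //.
Qed.

Lemma mem_tuple_vars U t x : t \in U -> x \in tvars t -> x \in tuple_vars U.
Proof.
by move=> tU xt; rewrite mem_undup; apply/flattenP; exists (tvars t); rewrite ?map_f.
Qed.

Lemma canon_variant U J : tuple_variant U J -> canon_tuple U = canon_tuple J.
Proof.
case=> r [inj_r <-]; rewrite /canon_tuple tuple_vars_ren // -map_comp.
apply/eq_in_map => t tU /=; rewrite tsub_comp; apply: tsub_eq_in => x xt /=.
by rewrite /ren index_map_in //; apply: mem_tuple_vars xt.
Qed.

Lemma tuple_vars_canon U :
  tuple_vars (canon_tuple U) = iota 0 (size (tuple_vars U)).
Proof.
rewrite tuple_vars_ren; last exact: index_inj.
have : uniq (tuple_vars U) by apply: undup_uniq.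
move: (tuple_vars U) => V uV; apply: (@eq_from_nth _ 0).
  by rewrite size_map size_iota.
move=> i; rewrite size_map => lt_i.
by rewrite (nth_map 0) // nth_iota // index_uniq.
Qed.

Lemma variant_canon U J : canon_tuple U = canon_tuple J -> tuple_variant U J.
Proof.
move=> e; have sz : size (tuple_vars U) = size (tuple_vars J).
  by have := congr1 (size \o @tuple_vars F) e; rewrite /= !tuple_vars_canon !size_iota.
(* Each variable of [U] goes to its canonical number, then to the variable of [J] with that
   number. *)
exists (nth 0 (tuple_vars J) \o index^~ (tuple_vars U)); split.
  move=> x y xU yU /= /eqP; rewrite nth_uniq ?undup_uniq ?index_mem -?sz ?index_mem //.
  by move/eqP/index_inj; apply.
transitivity (map (tsub (ren F (nth 0 (tuple_vars J)))) (canon_tuple U)).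
  by rewrite -map_comp; apply: eq_map => t /=; rewrite tsub_comp.
rewrite e -map_comp -[RHS]map_id; apply/eq_in_map => t tJ /=.
rewrite tsub_comp -[RHS]tsub_Var; apply: tsub_eq_in => x xt /=.
by rewrite /ren nth_index //; apply: mem_tuple_vars xt.
Qed.

(** * Finitely many canonical tuples of bounded length and term size *)

Fixpoint seqs_upto T (l : seq T) (n : nat) : seq (seq T) :=
  [::] :: if n is n'.+1 then [seq x :: l' | x <- l, l' <- seqs_upto l n'] else [::].

Lemma mem_seqs_upto (T : eqType) (l : seq T) n (s : seq T) :
  size s <= n -> {subset s <= l} -> s \in seqs_upto l n.
Proof.
elim: n s => [|n IH] [|x s] //= le_n sub; rewrite inE; apply/orP; right.
apply/allpairsP; exists (x, s); split=> //=; first by rewrite sub ?mem_head.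
by apply: IH => // y ys; rewrite sub // inE ys orbT.
Qed.

(** [n] limits depth and width at once: in a term of size at most [n'.+1], the arguments have size
    at most [n'], and there are at most [n'] of them since each has size at least 1. *)
Fixpoint terms_upto (Fs : seq F) (N n : nat) : seq (term F) :=
  if n is n'.+1 then
    map (Var F) (iota 0 N) ++
    [seq App f ts | f <- Fs, ts <- seqs_upto (terms_upto Fs N n') n']
  else [::].

Lemma size_le_tsizes ts : size ts <= sumn (map (@tsize F) ts).
Proof. by elim: ts => //= t ts IH; rewrite -add1n leq_add // tsize_gt0. Qed.

Lemma mem_terms_upto Fs N n t :
  term_over Fs t -> {in tvars t, forall x, x < N} -> tsize t <= n ->
  t \in terms_upto Fs N n.
Proof.
elim: n t => [|n IH] [x|f ts] //= tF tN; rewrite ?ltnS => le_n; rewrite mem_cat.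
  by rewrite map_f // mem_iota tN // inE.
case/andP: tF => fF /allP tsF; apply/orP; right; apply/allpairsP.
exists (f, ts); split=> //=; apply: mem_seqs_upto.
  exact: leq_trans (size_le_tsizes ts) le_n.
move=> u u_ts; apply: IH; first exact: tsF.
  by move=> x xu; apply: tN; apply/flattenP; exists (tvars u); rewrite ?map_f.
exact: leq_trans (tsize_arg u_ts) le_n.
Qed.

(** At most [l] terms of size at most [b] contain at most [l * b] variables, so canonical variables
    stay below [l * b]. *)
Definition canons_upto (Fs : seq F) (b l : nat) : seq (seq (term F)) :=
  seqs_upto (terms_upto Fs (l * b) b) l.

Lemma mem_canons_upto Fs b l U :
  size U <= l -> all (term_over Fs) U -> tuple_bounded b U ->
  canon_tuple U \in canons_upto Fs b l.
Proof.
move=> le_l /allP oU bU; apply: mem_seqs_upto; first by rewrite size_map.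
move=> _ /mapP[t tU ->]; apply: mem_terms_upto; first by rewrite over_ren oU.
  move=> _ /[!tvars_ren] /mapP[x xt ->].
  apply: leq_trans (_ : size (tuple_vars U) <= _).
    by rewrite index_mem; apply: mem_tuple_vars xt.
  by apply: leq_trans (size_tuple_vars bU) _; rewrite leq_mul2r le_l orbT.
by rewrite tsize_ren; apply: (allP bU).
Qed.

Section Atoms.
Variable Q : eqType.
Implicit Types A B : atom F Q.

Lemma mgu_exists s A B : unifier s A B -> exists th, mgu th A B.
Proof.
case: A B => p ts [q us]; rewrite /mgu /unifier /asub /= => -[pq e].
have sz : size ts = size us by have := congr1 size e; rewrite !size_map.
have zipE s' : (map (tsub s') ts = map (tsub s') us) <-> unifies s' (zip ts us).
  split=> [|].
    elim: ts us {e sz} => [|t ts IH] [|u us] //= [-> /IH] h.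
    by rewrite eqxx.
  elim: ts us sz {e} => [|t ts IH] [|u us] //= [/IH h] /andP[/eqP-> /h ->] //.
have [th [thE mg]] := solvable_all (ex_intro _ s ((zipE s).1 e)).
exists th; split; first by rewrite pq; congr Atom; apply/zipE.
by move=> s' [_ /zipE /mg h]; exists s'.
Qed.

(** [erase Fs \o th] is again a unifier, hence an instance of [th]. As this instance has no symbol
    outside [Fs], neither has [th]. *)
Lemma mgu_over Fs th A B :
  mgu th A B -> all (term_over Fs) (args A) -> all (term_over Fs) (args B) ->
  forall x, term_over Fs (th x).
Proof.
move=> [uth mg] /allP oA /allP oB.
have [|d dE x] := mg (erase Fs \o th); last first.
  by apply: (@over_of_tsub _ d); rewrite -dE over_erase.
case: A B uth oA oB {mg} => p ts [q us] [pq e] /= oA oB; rewrite /unifier /asub /= pq.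
congr Atom.
have eE vs : {in vs, forall t, term_over Fs t} ->
    map (tsub (erase Fs \o th)) vs = map (erase Fs) (map (tsub th) vs).
  by move=> ovs; rewrite -map_comp; apply/eq_in_map => t /ovs o_t /=; rewrite erase_tsub.
by rewrite !eE // e.
Qed.

Lemma over_bind Fs (X : seq nat) U x : all (term_over Fs) U -> term_over Fs (bind X U x).
Proof.
move=> /allP oU; rewrite /bind; have [lt|ge] := ltnP (index x X) (size U).
  by apply: oU; rewrite mem_nth.
by rewrite nth_default.
Qed.

Definition akey A := (pred_of A, canon_tuple (args A)).

Lemma akey_variant A B : variant A B <-> akey A = akey B.
Proof.
rewrite /akey /pred_of /variant; split=> [[-> v]|[-> _ /variant_canon] //].
rewrite (canon_variant v); congr (_, _, _).
by case: v => r [_ <-]; rewrite size_map.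
Qed.

Lemma anc_variantE A (x : nat * atom F Q) : anc_variant A x = (akey x.2 == akey A).
Proof. by apply/asboolP/eqP => /akey_variant. Qed.

End Atoms.

End Terms.

(** * Ranks of predicates *)

Lemma onth_rcons T (l : seq T) x i :
  onth (rcons l x) i = if i == size l then Some x else onth l i.
Proof. by elim: l i => [|y l IH] [|i] //=; case: i. Qed.

Lemma onth_lt T (l : seq T) i x : onth l i = Some x -> i < size l.
Proof. by move=> e; rewrite -onthTE e. Qed.

Lemma onth_rcons_old T (l : seq T) x i y :
  onth l i = Some y -> onth (rcons l x) i = Some y.
Proof. by move=> e; rewrite onth_rcons (ltn_eqF (onth_lt e)). Qed.

Lemma onth_update T (f : T -> T) i (l : seq T) k :
  onth (update f i l) k = if k == i then omap f (onth l k) else onth l k.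
Proof.
have nilE j : onth (@nil T) j = None by case: j.
elim: l i k => [|x l IH] i k; last first.
  by case: i k => [|i] [|k] //=; apply: IH.
by case: i => [|i]; rewrite !nilE //; [case: k | case: (k == i.+1)].
Qed.

Lemma size_update T (f : T -> T) i (l : seq T) : size (update f i l) = size l.
Proof. by elim: l i => [|x l IH] [|i] //=; rewrite IH. Qed.

Lemma map_update T S (g : T -> S) (f : T -> T) (f' : S -> S) i (l : seq T) :
  (forall x, g (f x) = f' (g x)) -> map g (update f i l) = update f' i (map g l).
Proof. by move=> gf; elim: l i => [|x l IH] [|i] //=; rewrite ?gf ?IH. Qed.

Lemma map_update_id T S (g : T -> S) (f : T -> T) i (l : seq T) :
  (forall x, g (f x) = g x) -> map g (update f i l) = map g l.
Proof. by move=> gf; elim: l i => [|x l IH] [|i] //=; rewrite ?gf ?IH. Qed.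

Lemma count_lt (T : eqType) (x : T) (a1 a2 : pred T) (l : seq T) :
  x \in l -> subpred a1 a2 -> a2 x -> ~~ a1 x -> count a1 l < count a2 l.
Proof.
move=> xl sub a2x a1x; rewrite -(size_filter a2) -(count_predC a1 (filter a2 l)).
rewrite !count_filter.
have -> : count (predI a1 a2) l = count a1 l.
  by apply: eq_count => y /=; case: (boolP (a1 y)) => // /sub.
rewrite -[X in X < _]addn0 ltn_add2l -has_count; apply/hasP.
by exists x; rewrite //= a1x.
Qed.

Section Rank.
Variables (F Q : eqType) (P : program F Q).

Definition reaches (p q : Q * nat) : Prop :=
  exists c, path (depends P) p (rcons c q).

Lemma depends_reaches p q r : depends P p q -> reaches q r -> reaches p r.
Proof. by move=> pq [c qr]; exists (q :: c); rewrite /= pq. Qed.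

Lemma depends_reaches1 p q : depends P p q -> reaches p q.
Proof. by move=> pq; exists [::]; rewrite /= pq. Qed.

Definition rank (p : Q * nat) : nat :=
  count (fun q => `[< q = p \/ reaches p q >]) (map (fun C => pred_of (head C)) P).

Lemma rank_le p q : depends P p q -> rank q <= rank p.
Proof.
move=> pq; apply: sub_count => r /asboolP[->|qr]; apply/asboolP; right.
  exact: depends_reaches1.
exact: depends_reaches qr.
Qed.

(** [p] heads a clause because of the edge to [q], so it counts in its own rank; it does not count
    in that of [q], since a path from [q] back to [p] would close a cycle. *)
Lemma rank_lt p q : depends P p q -> ~ tabled P p -> rank q < rank p.
Proof.
move=> pq ntp; apply: (@count_lt _ p).
- by case/hasP: (pq) => C CP /andP[/eqP <- _]; apply: map_f.
- move=> r /asboolP[->|qr]; apply/asboolP; right; first exact: depends_reaches1.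
  exact: depends_reaches qr.
- by apply/asboolP; left.
apply/asboolP => -[pq'|qp]; apply: ntp; last exact: depends_reaches qp.
by apply: depends_reaches1; rewrite {2}pq'.
Qed.
End Rank.

(** * Invariants of the tree *)

Section Machine.
Variables (F Q : eqType) (P : program F Q).
(** Finite data fixed at the end: the function symbols and predicates that may occur, the bound [b]
    on term sizes, the bound [L] on the variables of a tabled subgoal (hence on the length of
    answers), the bound [W] on label weights, and in [keys] all subgoals up to variants. *)
Variables (Fs : seq F) (Qs : seq (Q * nat)) (b L W : nat).
Variable keys : seq (Q * nat * seq (term F)).

Definition atom_ok (A : atom F Q) := (pred_of A \in Qs) && all (term_over Fs) (args A).

Hypothesis P_ok : {in P, forall C, atom_ok (head C) /\ all atom_ok (body C)}.
Hypothesis keysP :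
  forall A, atom_ok A -> tuple_bounded b (args A) -> akey A \in keys.
Hypothesis LP :
  forall A, atom_ok A -> tuple_bounded b (args A) -> size (atom_vars A) <= L.

(** Number of pairs of a key and a clause number from 0 to [size P]; it bounds the length of
    ancestor lists. [T] below bounds the answers of one table. *)
Let D := size keys * (size P).+1.
Let T := size (canons_upto Fs b L).

Implicit Types (ns : seq (node F Q)) (nd : node F Q) (G : goal F Q)
  (A B : atom F Q) (x : item F Q) (th : subst F) (s : state F Q)
  (AL : seq (nat * atom F Q)) (ks : seq (nat * atom F Q * nat)).

(** * Weights of goals *)

Definition max_body := \max_(C <- P) size (body C).

(** A lexicographic pair in one number: the second component is at most [D], so the first one gets
    the factor [D.+1]. *)
Definition call_rank A AL := rank P (pred_of A) * D.+1 + (D - size AL).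

Definition item_weight x :=
  if x is Call A AL then max_body.+2 ^ call_rank A AL else 1.

Definition weight G := sumn (map item_weight G).

Definition is_return x := if x is Return _ then true else false.

Definition proceeds G := if G is x :: _ then ~~ is_return x else false.

Lemma pred_of_asub th A : pred_of (asub th A) = pred_of A.
Proof. by rewrite /pred_of /= size_map. Qed.

Lemma weight_gsub th G : weight (gsub th G) = weight G.
Proof.
rewrite /weight; elim: G => //= -[A AL|h A U|Z] G IH //=.
  by rewrite IH /call_rank pred_of_asub.
by rewrite IH.
Qed.

Lemma weight_isub th G : weight (map (isub th) G) = weight G.
Proof.
rewrite /weight -map_comp; congr sumn; apply: eq_map => -[A AL|h A U|Z] //=.
by rewrite /call_rank pred_of_asub.
Qed.

Lemma weight_cat G G' : weight (G ++ G') = weight G + weight G'.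
Proof. by rewrite /weight map_cat sumn_cat. Qed.

Lemma has_return_gsub th G : has is_return (gsub th G) = has is_return G.
Proof. by elim: G => //= -[A AL|h A U|Z] G IH //=; rewrite IH. Qed.

Lemma mem_gsub th G y :
  y \in gsub th G -> exists2 x, x \in G & y = x \/ y = isub th x.
Proof.
elim: G => // x G IH.
have -> : (gsub th (x :: G)) =
    isub th x :: (if x is MemoLook _ _ _ then G else gsub th G) by case: x.
rewrite inE => /predU1P[->|yG]; first by exists x; rewrite ?mem_head //; right.
suff [z zG yz] : exists2 z, z \in G & y = z \/ y = isub th z.
  by exists z => //; rewrite inE zG orbT.
by case: x yG => [A AL /IH|h A U yG|Z /IH] //; exists y => //; left.
Qed.

(** The successor on the left is the weight of the [memo_look] added after the body of a tabled
    clause. A positive [m] is essential: for [m = 0] the body is empty, but the [memo_look] already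
    weighs as much as the call. *)
Lemma weight_calls AL As m :
  {in As, forall A, call_rank A AL < m} -> size As <= max_body -> 0 < m ->
  (weight (calls AL As)).+1 < max_body.+2 ^ m.
Proof.
case: m => // m lt_m le_b _.
have : weight (calls AL As) <= size As * max_body.+2 ^ m.
  elim: As lt_m {le_b} => // A As IH lt_m.
  rewrite /weight /= mulSn leq_add //.
    by rewrite leq_exp2l // -ltnS lt_m ?mem_head.
  by apply: IH => B BAs; apply: lt_m; rewrite inE BAs orbT.
have := leq_mul2r (max_body.+2 ^ m) (size As) max_body; rewrite le_b orbT.
have : 0 < max_body.+2 ^ m by rewrite expn_gt0.
by rewrite expnS; nia.
Qed.

(* [used ns i h j]: the branch leading to node i leaves its ancestor h
   through the clause number j. *)
Inductive used ns : nat -> nat -> nat -> Prop :=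
  | used_here i nd h j : onth ns i = Some nd -> parent nd = Some h ->
      via nd = Some j -> used ns i h j
  | used_up i nd f h j : onth ns i = Some nd -> parent nd = Some f ->
      used ns f h j -> used ns i h j.

(** [ks] decorates each ancestor with the clause through which the branch leaves it. The closest
    ancestor comes first, so among variants the numbers increase towards the node. *)
Definition chain_ok ns i AL ks : Prop :=
  [/\ map fst ks = AL,
      {in ks, forall e, [/\ used ns i e.1.1 e.2, akey e.1.2 \in keys & e.2 <= size P]} &
      pairwise (fun e e' => (akey e.1.2 == akey e'.1.2) ==> (e'.2 < e.2)) ks].

(** Equal keys force different clause numbers, so the pairs of a key and a number are distinct, and
    [D] counts all possible pairs. *)
Lemma chain_size ns i AL ks : chain_ok ns i AL ks -> size AL <= D.
Proof.
case=> <- ksP pw; rewrite size_map.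
pose g (e : nat * atom F Q * nat) := (akey e.1.2, e.2).
have ug : uniq (map g ks).
  rewrite uniq_pairwise pairwise_map; apply: sub_pairwise pw => e e' /=.
  apply: contraTneq => ge; rewrite (congr1 fst ge : akey _ = akey _).
  by rewrite (congr1 snd ge : e.2 = e'.2) eqxx ltnn.
have sub : {subset map g ks <= [seq (k, j) | k <- keys, j <- iota 0 (size P).+1]}.
  move=> _ /mapP[e /ksP[_ ek le_e] ->]; apply/allpairsP; exists (g e).
  by split=> //; rewrite mem_iota ltnS.
by have := uniq_leq_size ug sub; rewrite size_map size_allpairs size_iota.
Qed.

(** [n] is the weight of the label containing the item. For a [memo_look], node [h] must be heavier
    than that label because its answer pointer pays for the child. *)
Definition item_ok ns i n x : Prop :=
  match x with
  | Call A AL => atom_ok A /\ exists ks, chain_ok ns i AL ks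
  | MemoLook h A U =>
      [/\ all (term_over Fs) U, size U <= L &
          exists2 nd, onth ns h = Some nd & n < weight (label nd)]
  | Return _ => True
  end.

(** A final [Return] keeps resolvents nonempty. Only an empty label may lie below a goal that starts
    with [Return], so backtracking from a nonempty label always meets one of the Cases B1 to B3. *)
Definition node_ok ns i nd : Prop :=
  [/\ forall f, parent nd = Some f -> exists nf,
        [/\ onth ns f = Some nf, weight (label nd) < weight (label nf) &
            label nd = [::] \/ proceeds (label nf)],
      label nd = [::] \/ has is_return (label nd),
      weight (label nd) <= W &
      {in label nd, forall x, item_ok ns i (weight (label nd)) x}].

Definition tree_ok ns : Prop := forall i nd, onth ns i = Some nd -> node_ok ns i nd.

Definition extends ns ns' : Prop := forall i nd, onth ns i = Some nd ->
  exists nd', [/\ onth ns' i = Some nd', parent nd' = parent nd,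
                  via nd' = via nd & label nd' = label nd].

Lemma used_extends ns ns' i h j : extends ns ns' -> used ns i h j -> used ns' i h j.
Proof.
move=> ext; elim=> {i h j} [i nd h j /ext[nd' [e <- <- _]]|i nd f h j /ext[nd' [e <- _ _]] p _].
  exact: used_here.
exact: (used_up e p).
Qed.

Lemma chain_mono ns ns' i i' AL ks :
  (forall h j, used ns i h j -> used ns' i' h j) ->
  chain_ok ns i AL ks -> chain_ok ns' i' AL ks.
Proof. by move=> sub [<- ksP pw]; split=> // e /ksP[/sub]. Qed.

Lemma item_mono ns ns' i i' n n' x :
  extends ns ns' -> (forall h j, used ns i h j -> used ns' i' h j) -> n' <= n ->
  item_ok ns i n x -> item_ok ns' i' n' x.
Proof.
move=> ext sub le_n; case: x => //= [A AL [-> [ks h]]|h A U [oU LU [nd e lt_n]]].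
  by split=> //; exists ks; apply: chain_mono h.
have [nd' [e' _ _ l]] := ext _ _ e.
by split=> //; exists nd'; rewrite // l (leq_ltn_trans le_n).
Qed.

Lemma node_mono ns ns' i nd nd' : extends ns ns' ->
  parent nd' = parent nd -> label nd' = label nd -> node_ok ns i nd -> node_ok ns' i nd'.
Proof.
move=> ext ep el [par ret leW its]; split; rewrite ?ep ?el //.
  move=> f /par[nf [e lt pr]]; have [nf' [e' _ _ l]] := ext _ _ e.
  by exists nf'; rewrite l.
move=> x /its; apply: item_mono => // h j; exact: used_extends.
Qed.

Lemma tree_ext ns ns' : extends ns ns' -> extends ns' ns -> tree_ok ns -> tree_ok ns'.
Proof.
move=> ext ext' ok i nd /ext'[nd' [/ok h p _ l]].
exact: node_mono ext _ _ h.
Qed.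

Lemma extends_rcons ns nd : extends ns (rcons ns nd).
Proof. by move=> i nd' e; exists nd'; split=> //; apply: onth_rcons_old. Qed.

Lemma extends_refl ns : extends ns ns.
Proof. by move=> i nd e; exists nd. Qed.

Lemma extends_trans ns1 ns2 ns3 :
  extends ns1 ns2 -> extends ns2 ns3 -> extends ns1 ns3.
Proof.
move=> e12 e23 i nd /e12[nd2 [/e23[nd3 [e p v l]] p' v' l']].
by exists nd3; split; rewrite ?p ?v ?l.
Qed.

Lemma tree_rcons ns nd :
  tree_ok ns -> node_ok (rcons ns nd) (size ns) nd -> tree_ok (rcons ns nd).
Proof.
move=> ok okn i nd'; rewrite onth_rcons; case: eqP => [-> [<-] //|_ /ok].
by apply: node_mono => //; apply: extends_rcons.
Qed.

Definition static (f : node F Q -> node F Q) : Prop := forall nd,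
  [/\ parent (f nd) = parent nd, via (f nd) = via nd & label (f nd) = label nd].

Lemma update_extends f k ns :
  static f -> extends ns (update f k ns) /\ extends (update f k ns) ns.
Proof.
move=> st; split=> i nd; rewrite onth_update.
  move=> e; have [p v l] := st nd; case: eqP => _; last by exists nd.
  by exists (f nd); rewrite e.
case: eqP => _; last by move=> e; exists nd.
case e: (onth ns i) => [nd'|] //= -[<-]; have [p v l] := st nd'.
by exists nd'.
Qed.

Lemma used_old ns nd i h j : tree_ok ns -> i < size ns ->
  used (rcons ns nd) i h j -> used ns i h j.
Proof.
move=> ok + u; elim: u => {i h j} [i nd' h j e p v|i nd' f h j e p _ IH] lt_i.
  move: e; rewrite onth_rcons (ltn_eqF lt_i) => e; exact: used_here e p v.
move: e; rewrite onth_rcons (ltn_eqF lt_i) => e.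
case: (ok _ _ e) => /(_ _ p)[nf [ef _ _]] _ _ _.
exact: used_up e p (IH (onth_lt ef)).
Qed.

Lemma used_weight ns i h j : tree_ok ns -> used ns i h j ->
  exists nd nh, [/\ onth ns i = Some nd, onth ns h = Some nh &
                    weight (label nd) < weight (label nh)].
Proof.
move=> ok; elim=> {i h j} [i nd h j e p v|i nd f h j e p _ [nf [nh [ef eh lt]]]].
  by case: (ok _ _ e) => /(_ _ p)[nh [eh lt _]]; exists nd, nh.
exists nd, nh; split=> //; case: (ok _ _ e) => /(_ _ p)[nf' [ef' lt' _]] _ _ _.
by move: ef'; rewrite ef => -[?]; subst nf'; apply: ltn_trans lt.
Qed.

(** Weights increase strictly towards the root. Hence moving the clause pointer of the current node
    cannot disturb those of its ancestors. *)
Lemma used_neq ns i h j : tree_ok ns -> used ns i h j -> h != i.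
Proof.
move=> ok /(used_weight ok)[nd [nh [ei eh lt]]].
by apply/eqP => hi; move: eh lt; rewrite hi ei => -[->]; rewrite ltnn.
Qed.

(* The clause in use at an ancestor of the current node is the one before its
   clause pointer. *)
Definition live ns i : Prop := forall h j, used ns i h j ->
  exists2 nd, onth ns h = Some nd & clause_ptr nd = j.+1.

Lemma live_parent ns i nd f :
  onth ns i = Some nd -> parent nd = Some f -> live ns i -> live ns f.
Proof. by move=> e p lv h j u; apply: lv; apply: used_up e p u. Qed.

(** A clause number above [node_ANC] then exceeds the numbers used at all variant ancestors, not
    only at the closest one, which is what extending the chain requires. *)
Definition anc_ok ns : Prop := forall i nd j A AL G,
  onth ns i = Some nd -> node_ANC nd = Some j -> label nd = Call A AL :: G ->
  exists2 ks, chain_ok ns i AL ks &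
    {in ks, forall e, akey e.1.2 = akey A -> e.2 <= j}.

(** [live] is required at the current node only: off the current branch, a clause pointer may have
    moved past the clause recorded in an old child. *)
Definition control_ok ns (c : control) : Prop :=
  match c with
  | Goto2 i | Goto3 i =>
      exists nd, [/\ onth ns i = Some nd, label nd <> [::] & live ns i]
  | Goto42 i => exists nd A AL G,
      [/\ onth ns i = Some nd, label nd = Call A AL :: G,
          live ns i & node_ANC nd = Some 0]
  | Goto43 i => exists nd A AL G,
      [/\ onth ns i = Some nd, label nd = Call A AL :: G,
          live ns i & node_ANC nd]
  | ReturnedNO => True
  end.

Definition new_node i v G : node F Q := Node (Some i) v G 0 1 false false false None.

Lemma live_update ns f k i : tree_ok ns -> static f -> live ns i ->
  (k = i \/ forall nd, clause_ptr (f nd) = clause_ptr nd) ->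
  live (update f k ns) i.
Proof.
move=> ok st lv fk h j.
move=> /(used_extends (update_extends k ns st).2) u.
have [nd e c] := lv _ _ u; rewrite onth_update e /=.
case: eqP => [hk|_]; last by exists nd.
exists (f nd) => //; case: fk => [ki|->//].
by have := used_neq ok u; rewrite hk ki eqxx.
Qed.

Lemma anc_update ns f k : static f -> (forall nd, node_ANC (f nd) = node_ANC nd) ->
  anc_ok ns -> anc_ok (update f k ns).
Proof.
move=> st fa ok i nd j A AL G e a l.
have [nd' [e' p v l']] := (update_extends k ns st).2 _ _ e.
have a' : node_ANC nd' = Some j.
  move: e; rewrite onth_update e'; case: eqP => _ [nd'E]; first by rewrite -fa nd'E.
  by rewrite nd'E.
have [ks ksok kj] := ok _ _ _ _ _ _ e' a' (etrans l' l).
exists ks => //; apply: chain_mono ksok => h j'; apply: used_extends.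
exact: (update_extends k ns st).1.
Qed.

(** [f] is the pointer move made before registration. It takes place at [k], which is [i] for a
    clause but may be N_h for a [memo_look]. The conditions on [v] preserve [live]: a clause edge
    records the clause just fetched, any other edge leaves clause pointers alone. *)
Lemma child_ok ns i nd f k v G :
  let ns' := rcons (update f k ns) (new_node i v G) in
  tree_ok ns -> anc_ok ns -> live ns i -> onth ns i = Some nd ->
  static f -> (forall nd, node_ANC (f nd) = node_ANC nd) ->
  (forall j, v = Some j -> k = i /\ forall nd, clause_ptr (f nd) = j.+1) ->
  (v = None -> forall nd, clause_ptr (f nd) = clause_ptr nd) ->
  weight G < weight (label nd) ->
  G = [::] \/ has is_return G -> G = [::] \/ proceeds (label nd) ->
  {in G, forall x, item_ok ns' (size ns) (weight G) x} ->
  [/\ tree_ok ns', anc_ok ns' & live ns' (size ns)].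
Proof.
move=> ns' ok anc lv e st fa fv fv0 lt ret pr its.
have [ext1 ext2] := update_extends k ns st.
have ok1 := tree_ext ext1 ext2 ok.
have ext : extends ns ns' := extends_trans ext1 (@extends_rcons _ _).
have sz : size (update f k ns) = size ns by rewrite size_update.
split.
- apply: tree_rcons => //; rewrite sz; split=> //=.
    move=> _ [<-]; have [nd' [e' _ _ l]] := ext _ _ e.
    by exists nd'; rewrite l.
  by apply: ltnW; apply: leq_trans lt _; case: (ok _ _ e).
- move=> i' nd' j A AL G'; rewrite onth_rcons; case: eqP => [_ [<-] //|_].
  move=> e' a l; have [ks ksok kj] := anc_update st fa anc e' a l.
  exists ks => //; apply: chain_mono ksok => h j'; apply: used_extends.
  exact: extends_rcons.
have lv1 : live (update f k ns) i.
  apply: live_update => //; case: v fv fv0 {ns' its ext} => [j|] fv fv0; last by right; apply: fv0.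
  by left; case: (fv j).
have e0 : onth ns' (size ns) = Some (new_node i v G) by rewrite onth_rcons sz eqxx.
move=> h j u; inversion u as [? nd0 ? ? e1 p1 v1|? nd0 f0 ? ? e1 p1 u1]; subst.
  move: e1; rewrite e0 => -[?]; subst nd0; move: p1 v1 => /= -[?] ?; subst.
  have [? fj] := fv j erefl; subst k.
  exists (f nd); rewrite ?fj //; apply: onth_rcons_old.
  by rewrite onth_update eqxx e.
move: e1; rewrite e0 => -[?]; subst nd0; move: p1 => /= -[?]; subst f0.
have u2 : used (update f k ns) i h j.
  by apply: used_old u1; rewrite // sz (onth_lt e).
by have [nh eh c] := lv1 _ _ u2; exists nh => //; apply: onth_rcons_old.
Qed.

Lemma item_isub th ns i n x :
  (forall y, term_over Fs (th y)) -> item_ok ns i n x -> item_ok ns i n (isub th x).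
Proof.
have all_sub U : (forall y, term_over Fs (th y)) ->
    all (term_over Fs) U -> all (term_over Fs) (map (tsub th) U).
  by move=> oth /allP oU; rewrite all_map; apply/allP => t /oU; apply: over_tsub.
move=> oth; case: x => //= [A AL [/andP[pA aA] ks]|h A U [oU LU nd]].
  by split=> //; rewrite /atom_ok pred_of_asub pA /= all_sub.
by rewrite size_map; split=> //; apply: all_sub.
Qed.

Lemma clause_noP p j (C : clause F Q) : clause_no P p j = Some C ->
  [/\ 0 < j, j <= size P, C \in P & pred_of (head C) = p].
Proof.
case: j => // j /= e; have lt_j := onth_lt e.
have : C \in clauses_of P p by apply/onthP; exists j.
rewrite mem_filter => /andP[/eqP pC CP]; split=> //.
by apply: leq_trans lt_j _; rewrite size_filter count_size.
Qed.

Lemma atom_ok_asub th A :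
  (forall y, term_over Fs (th y)) -> atom_ok A -> atom_ok (asub th A).
Proof.
move=> oth /andP[pA /allP aA]; rewrite /atom_ok pred_of_asub pA /= all_map.
by apply/allP => t /aA; apply: over_tsub.
Qed.

Lemma instance_ok s A j C' th : instance_of P s A j C' th -> atom_ok A ->
  [/\ 0 < j <= size P, forall y, term_over Fs (th y), size (body C') <= max_body &
      {in body C', forall B, atom_ok B /\ depends P (pred_of A) (pred_of B)}].
Proof.
case=> C [/clause_noP[j0 jP CP pC] [[r [_ <-]] _] m] /andP[_ oA].
have [hC /allP bC] := P_ok CP; split.
- by rewrite j0.
- apply: mgu_over m _ oA.
  by case/andP: (atom_ok_asub (th := ren F r) (fun=> isT) hC).
- rewrite /= size_map /max_body.
  exact: (@leq_bigmax_seq _ _ xpredT (fun C : clause F Q => size (body C))).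
move=> _ /mapP[B BC ->]; split; first by apply: atom_ok_asub => //; apply: bC.
apply/hasP; exists C => //; rewrite pC eqxx pred_of_asub /=; exact: map_f.
Qed.

Lemma rank_callee A AL k B : depends P (pred_of A) (pred_of B) ->
  (size AL).+1 <= D -> call_rank B (k :: AL) < call_rank A AL.
Proof.
move=> /rank_le le_r lt_D; rewrite /call_rank -addnS.
by rewrite leq_add ?leq_mul2r ?le_r ?orbT //= ltn_sub2l.
Qed.

(** Emptying the ancestor list costs at most [D], less than the [D.+1] gained from one unit of
    rank. *)
Lemma rank_callee_nontabled A AL B :
  depends P (pred_of A) (pred_of B) -> ~ tabled P (pred_of A) ->
  call_rank B [::] < call_rank A AL.
Proof.
move=> d nt; have := rank_lt d nt; rewrite /call_rank subn0 => lt_r.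
have : (rank P (pred_of B)).+1 * D.+1 <= rank P (pred_of A) * D.+1 by rewrite leq_mul2r lt_r orbT.
by rewrite mulSn; lia.
Qed.

(** * Tables *)

Definition table_info (ts : seq (table F Q)) := [seq (t_goal tb, t_ans tb) | tb <- ts].

Definition info_ok (e : atom F Q * seq (seq (term F))) : Prop :=
  [/\ akey e.1 \in keys, {in e.2, forall U, all (term_over Fs) U /\ size U <= L} &
      uniq (map (@canon_tuple F) e.2)].

Definition tables_ok (ti : seq (atom F Q * seq (seq (term F)))) : Prop :=
  {in ti, forall e, info_ok e} /\ uniq [seq akey e.1 | e <- ti].

Definition tables_bounded (ts : seq (table F Q)) :=
  all (fun tb => all (tuple_bounded b) (t_ans tb)) ts.

Definition answers ts := sumn [seq size e.2 | e <- table_info ts].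

Lemma info_size e : info_ok e -> all (tuple_bounded b) e.2 -> size e.2 <= T.
Proof.
case=> _ oe ue /allP be; rewrite -(size_map (@canon_tuple F)); apply: uniq_leq_size ue _.
by move=> _ /mapP[U Ue ->]; have [oU sU] := oe U Ue; apply: mem_canons_upto (be _ Ue).
Qed.

Lemma table_info_bounded ts e :
  tables_bounded ts -> e \in table_info ts -> all (tuple_bounded b) e.2.
Proof. by move=> + et; elim: ts et => //= tb ts IH; rewrite inE => /predU1P[->|/IH h] /andP[]. Qed.

(** There is at most one table per key, with at most [T] answers in each. *)
Lemma answers_le ts : tables_ok (table_info ts) -> tables_bounded ts ->
  answers ts <= size keys * T.
Proof.
move=> [ok u] bt; have le_k : size (table_info ts) <= size keys.
  rewrite -(size_map (fun e => akey e.1)); apply: uniq_leq_size u _.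
  by move=> _ /mapP[e /ok[? _ _] ->].
apply: leq_trans (leq_mul le_k (leqnn T)); rewrite /answers.
have : {in table_info ts, forall e, size e.2 <= T}.
  by move=> e et; apply: info_size (ok _ et) (table_info_bounded bt et).
elim: (table_info ts) => //= e l IH h; rewrite mulSn leq_add ?h ?mem_head //.
by apply: IH => e' e'l; apply: h; rewrite inE e'l orbT.
Qed.

Lemma table_ofP s A tb : table_of s A = Some tb ->
  (t_goal tb, t_ans tb) \in table_info (tables s).
Proof.
move=> e; apply/onthP; exists (table_idx s A).
by rewrite /table_info onth_map; rewrite /table_of in e; rewrite e.
Qed.

Lemma table_of_None s A : table_of s A = None ->
  akey A \notin [seq akey e.1 | e <- table_info (tables s)].
Proof.
rewrite /table_of /table_idx => e.
have : ~~ has (fun tb => `[< variant A (t_goal tb) >]) (tables s).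
  by rewrite has_find -onthTE e.
elim: (tables s) {e} => //= tb ts IH; rewrite negb_or => /andP[nv /IH].
rewrite inE negb_or => ->; rewrite andbT.
by apply: contra nv => /eqP e; apply/asboolP/akey_variant.
Qed.

Lemma create_table_info G s : let s' := create_table P G s in
  table_info (tables s') = table_info (tables s) \/
  exists A AL G', [/\ G = Call A AL :: G', table_of s A = None &
    table_info (tables s') = rcons (table_info (tables s)) (A, [::])].
Proof.
case: G => [|[A AL|h A U|Z] G] /=; try by left.
case: ifP => [/andP[_]|_]; last by left.
case e: (table_of s A) => //= _; right; exists A, AL, G; split=> //.
by rewrite /table_info map_rcons.
Qed.

Lemma create_table_ok G s : let s' := create_table P G s in
  tables_ok (table_info (tables s)) ->
  (forall A AL G', G = Call A AL :: G' -> akey A \in keys) ->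
  tables_ok (table_info (tables s')) /\ answers (tables s') = answers (tables s).
Proof.
rewrite /= /answers => -[ok u] kG.
have [->//|[A [AL [G' [eG /table_of_None nA ->]]]]] := create_table_info G s.
split; last by rewrite map_rcons sumn_rcons addn0.
split; last by rewrite map_rcons rcons_uniq nA.
move=> e; rewrite mem_rcons inE => /predU1P[->|/ok //].
by split=> //=; apply: kG eG.
Qed.

Lemma table_info_upd A f s :
  (forall tb, t_goal (f tb) = t_goal tb /\ t_ans (f tb) = t_ans tb) ->
  table_info (tables (upd_table A f s)) = table_info (tables s).
Proof. by move=> fE; apply: map_update_id => tb; have [-> ->] := fE tb. Qed.

Definition memo_fresh A U s : Prop := exists tb, table_of s A = Some tb /\
  ~~ has (fun J => `[< tuple_variant U J >]) (t_ans tb).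

Lemma memo_id A U s : ~ memo_fresh A U s -> memo A U s = s.
Proof.
rewrite /memo /memo_fresh => nf; case e: (table_of s A) => [tb|] //.
by case: ifPn => // h; case: nf; exists tb.
Qed.

Lemma memo_new A U s : memo_fresh A U s ->
  table_info (tables (memo A U s)) =
    update (fun e => (e.1, rcons e.2 U)) (table_idx s A) (table_info (tables s)) /\
  NEW (memo A U s).
Proof.
move=> [tb [e nh]]; rewrite /memo e (negbTE nh).
have infoE : table_info (tables (set_NEW true (upd_table A (add_answer U) s))) =
   update (fun e => (e.1, rcons e.2 U)) (table_idx s A) (table_info (tables s)).
  exact: map_update.
by case: ifP => _; split=> //; rewrite -infoE //; apply: table_info_upd.
Qed.

Lemma memo_nodes A U s : nodes (memo A U s) = nodes s /\ ctrl (memo A U s) = ctrl s.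
Proof.
rewrite /memo; case: (table_of s A) => // tb; case: ifP => // _.
by case: ifP.
Qed.

Lemma sumn_update T0 (g : T0 -> nat) (f : T0 -> T0) i (l : seq T0) a :
  onth l i = Some a ->
  sumn (map g (update f i l)) + g a = sumn (map g l) + g (f a).
Proof.
elim: l i => [|y l IH] [|i] //=; first by move=> [->]; lia.
by move=> /IH; lia.
Qed.

Lemma memo_ok A U s : all (term_over Fs) U -> size U <= L ->
  tables_ok (table_info (tables s)) -> tables_ok (table_info (tables (memo A U s))).
Proof.
move=> oU sU; have [fr|/memo_id -> //] := pselect (memo_fresh A U s).
have [-> _] := memo_new fr; case: fr => tb [e nh] [ok u].
split; last by rewrite map_update_id.
move=> x /onthP[i]; rewrite onth_update; case: eqP => [->|_]; last first.
  by move=> xi; apply: ok; apply/onthP; exists i.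
have e' : onth (table_info (tables s)) (table_idx s A) = Some (t_goal tb, t_ans tb).
  by rewrite /table_info onth_map; rewrite /table_of in e; rewrite e.
rewrite e' /= => -[<-]; have [kt ot ut] := ok _ (table_ofP e).
split=> //= [J|]; first by rewrite mem_rcons inE => /predU1P[->|/ot].
rewrite map_rcons rcons_uniq ut andbT; apply: contra nh => /mapP[J Jt eJ].
by apply/hasP; exists J => //; apply/asboolP/variant_canon.
Qed.

Definition global_measure s := (size keys * T - answers (tables s)).*2 + NEW s.

(** A new answer lowers the doubled term by 2 and raises [NEW] by at most 1. Boundedness is needed
    after the operation: the subtraction is truncated, so the new answer must still fit under
    [size keys * T]. *)
Lemma memo_measure A U s :
  tables_ok (table_info (tables (memo A U s))) -> tables_bounded (tables (memo A U s)) ->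
  memo A U s = s \/ global_measure (memo A U s) < global_measure s.
Proof.
move=> ok bt; have [fr|/memo_id -> //] := pselect (memo_fresh A U s); last by left.
right; have le := answers_le ok bt.
rewrite /global_measure; have [eI ->] := memo_new fr; case: fr => tb [e nh].
have e' : onth (table_info (tables s)) (table_idx s A) = Some (t_goal tb, t_ans tb).
  by rewrite /table_info onth_map; rewrite /table_of in e; rewrite e.
have := sumn_update (fun e => size e.2) (fun e => (e.1, rcons e.2 U)) e'.
move: le; rewrite /answers eI /= size_rcons => le eq.
by case: (NEW s); lia.
Qed.

(** * The measure and the steps *)

Definition norm nd : node F Q :=
  Node (parent nd) (via nd) (label nd) (answer_ptr nd) (clause_ptr nd)
       false false false (node_ANC nd).

(* The nodes without the flags SUSP, node_LOOP and node_ITER, which play no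
   role in termination. *)
Definition core s := map norm (nodes s).

Lemma onth_core s i nd : onth (nodes s) i = Some nd -> onth (core s) i = Some (norm nd).
Proof. by rewrite /core onth_map => ->. Qed.

Lemma core_upd_node i f f' s : (forall nd, norm (f nd) = f' (norm nd)) ->
  core (upd_node i f s) = update f' i (core s).
Proof. exact: map_update. Qed.

Lemma core_upd_flags i f s : (forall nd, norm (f nd) = norm nd) ->
  core (upd_node i f s) = core s.
Proof. exact: map_update_id. Qed.

Lemma core_foldr f l s : (forall nd, norm (f nd) = norm nd) ->
  core (foldr (fun k => upd_node k f) s l) = core s.
Proof. by move=> fE; elim: l => //= k l IH; rewrite core_upd_flags. Qed.

Lemma core_create G s : core (create_table P G s) = core s.
Proof. by case: G => [|[A AL|h A U|Z] G] //=; case: ifP. Qed.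

Lemma core_register i v G s :
  core (register_child P i v G s) = rcons (core s) (new_node i v G).
Proof.
have -> : core (register_child P i v G s) = core (register P (Some i) v G s) by [].
by rewrite /register core_create /core map_rcons.
Qed.

Lemma core_nodetype h mid i s nd : onth (nodes s) h = Some nd ->
  core (nodetype_update h mid i s) =
    update (set_ANC (Some (clause_ptr nd).-1)) i (core s).
Proof.
move=> e; rewrite /nodetype_update e core_foldr //.
rewrite (@core_upd_node _ _ (set_ANC (Some (clause_ptr nd).-1))) //; congr update.
by rewrite core_upd_flags ?core_foldr // => nd' /=; case: ifP.
Qed.

Lemma tables_foldr f l s : tables (foldr (fun k => upd_node k f) s l) = tables s /\
  NEW (foldr (fun k => upd_node k f) s l) = NEW s.
Proof. by elim: l => //= k l [-> ->]. Qed.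

Lemma tables_nodetype h mid i s :
  tables (nodetype_update h mid i s) = tables s /\
  NEW (nodetype_update h mid i s) = NEW s.
Proof.
rewrite /nodetype_update.
set s3 := upd_node i _ _; have [-> ->] := tables_foldr (set_SUSP true) (h :: mid) s3.
exact: (tables_foldr _ _ s).
Qed.

Definition remaining nd := (T - answer_ptr nd) + ((size P).+1 - clause_ptr nd).

(** A fresh node has [remaining] equal to [R = T + size P], since clause pointers start at 1. With
    weight [w.+1] its potential is [R * R.+1 ^ w], less than [R.+1 ^ w.+1], hence less than one move
    at any heavier node. An empty goal costs nothing. *)
Definition potential nd := remaining nd *
  (if weight (label nd) is w.+1 then (T + size P).+1 ^ w else 0).

Definition tree_measure ns := sumn (map potential ns).

Definition node_weight ns i := if onth ns i is Some nd then weight (label nd) else 0.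

(** The factor 4 leaves room for the offsets 1 to 3 of the phases at one node; a parent is heavier
    than its child, so returning to it lowers the first term. *)
Definition control_measure ns (c : control) :=
  match c with
  | Goto2 i => 4 * (W - node_weight ns i) + 3
  | Goto42 i | Goto43 i => 4 * (W - node_weight ns i) + 2
  | Goto3 i => 4 * (W - node_weight ns i) + 1
  | ReturnedNO => 0
  end.

Definition decreases s s' : Prop :=
  global_measure s' < global_measure s \/
  global_measure s' <= global_measure s /\
    (tree_measure (core s') < tree_measure (core s) \/
     tree_measure (core s') <= tree_measure (core s) /\
     control_measure (core s') (ctrl s') < control_measure (core s) (ctrl s)).

Definition inv s : Prop :=
  [/\ tree_ok (core s), tables_ok (table_info (tables s)), anc_ok (core s) &
      control_ok (core s) (ctrl s)].

Definition bounded s : Prop :=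
  (forall i nd, onth (core s) i = Some nd -> subgoals_bounded b (label nd)) /\
  tables_bounded (tables s).

Lemma tree_measure_child ns f k nd i v G : onth ns k = Some nd -> static f ->
  remaining (f nd) < remaining nd -> weight G < weight (label nd) ->
  tree_measure (rcons (update f k ns) (new_node i v G)) < tree_measure ns.
Proof.
move=> e st ltr ltw; rewrite /tree_measure map_rcons sumn_rcons.
have := sumn_update potential f e; rewrite /potential.
have -> : remaining (new_node i v G) = T + size P.
  by rewrite /remaining /= subn0 subSS subn0.
have [_ _ ->] := st nd; rewrite [label (new_node _ _ _)]/=.
case: (weight (label nd)) ltw => // w; rewrite ltnS => le_w.
set R := T + size P.
have lt_pot : R * match weight G with 0 => 0 | w'.+1 => R.+1 ^ w' end < R.+1 ^ w.
  case: (weight G) le_w => [|w'] le_w; first by rewrite muln0 expn_gt0.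
  apply: leq_trans (leq_pexp2l _ le_w) => //; rewrite expnS ltn_mul2r expn_gt0 /=.
  exact: ltnSn.
move: lt_pot; set p := R * _; set q := _ ^ w; nia.
Qed.
Definition current (c : control) : option nat :=
  match c with
  | Goto2 i | Goto42 i | Goto43 i | Goto3 i => Some i
  | ReturnedNO => None
  end.

Lemma current_ok s i nd : inv s -> current (ctrl s) = Some i ->
  onth (nodes s) i = Some nd ->
  [/\ onth (core s) i = Some (norm nd), label nd <> [::], live (core s) i &
      node_ok (core s) i (norm nd)].
Proof.
case=> ok _ _ + cur /onth_core e; have okn := ok _ _ e.
case: (ctrl s) cur => //= _ [->]; rewrite e.
- by case=> _ [[<-]].
- by case=> _ [A [AL [G [[<-] /= -> lv _]]]].
- by case=> _ [A [AL [G [[<-] /= -> lv _]]]].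
- by case=> _ [[<-]].
Qed.

Lemma node_weightE ns i nd : onth ns i = Some nd -> node_weight ns i = weight (label nd).
Proof. by rewrite /node_weight => ->. Qed.

Lemma global_measure_le s s' : table_info (tables s') = table_info (tables s) ->
  NEW s' <= NEW s -> global_measure s' <= global_measure s.
Proof. by rewrite /global_measure /answers => -> le; rewrite leq_add2l. Qed.

(** Covers the steps that touch only flags, clause statuses, completion or control: the control
    alone has to decrease. *)
Lemma move_ok s s' : core s' = core s ->
  table_info (tables s') = table_info (tables s) -> NEW s' <= NEW s ->
  control_ok (core s) (ctrl s') ->
  control_measure (core s) (ctrl s') < control_measure (core s) (ctrl s) ->
  inv s -> inv s' /\ decreases s s'.
Proof.
move=> ec et en co cm [ok okt anc _]; split; first by split; rewrite ?ec ?et.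
by right; split; [apply: global_measure_le | right; rewrite ec].
Qed.

Lemma remaining_answer nd : answer_ptr nd < T ->
  remaining (set_answer_ptr (answer_ptr nd).+1 nd) < remaining nd.
Proof. by rewrite /remaining /=; lia. Qed.

Lemma remaining_clause nd j : clause_ptr nd <= j <= size P ->
  remaining (set_clause_ptr j.+1 nd) < remaining nd.
Proof. by rewrite /remaining /= subSS ltn_add2l => /andP[]; lia. Qed.

Lemma lookup_ok s h A J : tables_ok (table_info (tables s)) -> tables_bounded (tables s) ->
  lookup s h A = Some J -> exists nd,
  [/\ onth (core s) h = Some nd, answer_ptr nd < T & all (term_over Fs) J].
Proof.
rewrite /lookup => -[ok _] bt; case e: (onth (nodes s) h) => [nd|] //.
case et: (table_of s A) => [tb|] // eJ; have tbi := table_ofP et.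
exists (norm nd); split; first exact: onth_core.
  have := info_size (ok _ tbi) (table_info_bounded bt tbi).
  by apply: leq_trans; apply: onth_lt eJ.
have [_ oJ _] := ok _ tbi; have : J \in t_ans tb by apply/onthP; exists (answer_ptr nd).
by case/oJ.
Qed.

Lemma fresh_tuple_over s J J' :
  fresh_tuple s J J' -> all (term_over Fs) J -> all (term_over Fs) J'.
Proof.
case=> [[r [_ <-]] _] /allP oJ; rewrite all_map; apply/allP => t /oJ /=.
by rewrite over_ren.
Qed.

Lemma create_bounded G s :
  tables_bounded (tables (create_table P G s)) -> tables_bounded (tables s).
Proof.
case: G => [|[A AL|h A U|Z] G] //=; case: ifP => // _.
by rewrite /tables_bounded all_rcons => /andP[].
Qed.

Lemma create_NEW G s : NEW (create_table P G s) = NEW s.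
Proof. by case: G => [|[A AL|h A U|Z] G] //=; case: ifP. Qed.

Lemma child_step s s0 i nd f k ndk v G :
  inv s -> onth (core s) i = Some nd -> live (core s) i ->
  core s0 = update f k (core s) -> onth (core s) k = Some ndk ->
  static f -> (forall nd', node_ANC (f nd') = node_ANC nd') ->
  (forall j, v = Some j -> k = i /\ forall nd', clause_ptr (f nd') = j.+1) ->
  (v = None -> forall nd', clause_ptr (f nd') = clause_ptr nd') ->
  remaining (f ndk) < remaining ndk ->
  weight G < weight (label ndk) -> weight G < weight (label nd) ->
  has is_return G -> proceeds (label nd) ->
  {in G, forall x, item_ok (rcons (update f k (core s)) (new_node i v G))
                     (size (core s)) (weight G) x} ->
  tables_ok (table_info (tables s0)) -> global_measure s0 <= global_measure s ->
  bounded (register_child P i v G s0) ->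
  inv (register_child P i v G s0) /\ decreases s (register_child P i v G s0).
Proof.
move=> [ok _ anc _] e lv ec ek st fa fv fv0 ltr ltk lti ret pr its okt le_g [bg _].
have [ok' anc' lv'] :=
  child_ok ok anc lv e st fa fv fv0 lti (or_intror ret) (or_intror pr) its.
have core' := core_register i v G s0; rewrite ec in core'.
have sz : size (nodes s0) = size (core s).
  by rewrite -[LHS](size_map norm) -/(core s0) ec size_update.
have eG : onth (core (register_child P i v G s0)) (size (core s)) = Some (new_node i v G).
  by rewrite core' onth_rcons size_update eqxx.
(* Boundedness of the new state is used here: it places a table that registration may create among
   [keys]. *)
have kG A AL G' : G = Call A AL :: G' -> akey A \in keys.
  move=> GE; have /= := bg _ _ eG; rewrite GE /= => /andP[bA _].
  by apply: keysP => //; have [] := its (Call A AL); rewrite GE ?mem_head.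
have [okt' ans'] := create_table_ok (s := set_nodes (rcons (nodes s0) (new_node i v G)) s0) okt kG.
split.
  split; rewrite ?core' //=.
  exists (new_node i v G); rewrite sz -core' eG core'; split=> //=.
  by move=> G0; rewrite G0 in ret.
right; split.
  apply: leq_trans le_g; rewrite /global_measure.
  rewrite [NEW _](create_NEW G (set_nodes (rcons (nodes s0) (new_node i v G)) s0)).
  by rewrite [answers _]ans'.
by left; rewrite core'; apply: tree_measure_child ek st ltr ltk.
Qed.

Lemma inherited_ok ns i nd f k v G n x : tree_ok ns -> onth ns i = Some nd ->
  static f -> x \in label nd -> n <= weight (label nd) ->
  item_ok (rcons (update f k ns) (new_node i v G)) (size ns) n x.
Proof.
move=> ok e st xl le_n; have [_ _ _ its] := ok _ _ e.
have ext := extends_trans (update_extends k ns st).1 (@extends_rcons _ (new_node i v G)).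
apply: item_mono le_n (its x xl) => // h j u.
apply: (@used_up _ _ (new_node i v G) i) => //; last exact: used_extends ext u.
by rewrite onth_rcons size_update eqxx.
Qed.

(** Serves both uses of answers: [k = i] for a tabled call, and [k] the node N_h for a [memo_look],
    after the memo operation has led to the tables of [s0]. *)
Lemma answer_step s s0 i nd ndk k x G' th :
  inv s -> onth (core s) i = Some nd -> live (core s) i ->
  label nd = x :: G' -> ~~ is_return x ->
  core s0 = update (fun nd' => set_answer_ptr (answer_ptr nd').+1 nd') k (core s) ->
  onth (core s) k = Some ndk -> answer_ptr ndk < T ->
  weight (label nd) <= weight (label ndk) ->
  (forall y, term_over Fs (th y)) ->
  tables_ok (table_info (tables s0)) -> global_measure s0 <= global_measure s ->
  bounded (register_child P i None (gsub th G') s0) ->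
  inv (register_child P i None (gsub th G') s0) /\
  decreases s (register_child P i None (gsub th G') s0).
Proof.
move=> iv e lv l nr ec ek lt_T le_k oth okt le_g bd; have [ok _ _ _] := iv.
have lt_w : weight (gsub th G') < weight (label nd).
  rewrite weight_gsub l /weight /= -[X in X < _]add0n ltn_add2r.
  by case: (x) => //= *; rewrite expn_gt0.
have ret : has is_return G'.
  by case: (ok _ _ e) => _ [] + _ _; rewrite l //= (negbTE nr).
apply: (child_step iv e lv ec ek) => //.
- exact: remaining_answer.
- exact: leq_trans lt_w le_k.
- by rewrite has_return_gsub.
- by rewrite l.
move=> y /mem_gsub[z zG yz].
have h := inherited_ok k None (gsub th G') ok e _ (_ : z \in label nd) (ltnW lt_w).
by case: yz => ->; [|apply: item_isub => //]; apply: h; rewrite // l inE zG orbT.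
Qed.
Lemma weight_calls_le AL As m :
  {in As, forall A, call_rank A AL < m} -> size As <= max_body ->
  weight (calls AL As) < max_body.+2 ^ m.
Proof.
case: m => [|m] lt_m le_b; last by apply: ltnW; apply: weight_calls.
by case: As lt_m le_b => // A As /(_ A (mem_head _ _)).
Qed.

Lemma mem_calls AL As x : x \in calls AL As -> exists2 A, A \in As & x = Call A AL.
Proof. by case/mapP=> A AAs ->; exists A. Qed.

Lemma has_return_calls AL As G :
  has is_return (calls AL As ++ G) = has is_return G.
Proof. by rewrite has_cat /calls has_map (eq_has (a2 := pred0)) ?has_pred0. Qed.

Lemma child_used ns i nd f k v G h j : onth ns i = Some nd -> static f ->
  used ns i h j -> used (rcons (update f k ns) (new_node i v G)) (size ns) h j.
Proof.
move=> e st u; apply: (@used_up _ _ (new_node i v G) i) => //.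
  by rewrite onth_rcons size_update eqxx.
have ext := extends_trans (update_extends k ns st).1 (@extends_rcons _ (new_node i v G)).
exact: used_extends ext u.
Qed.

Lemma core_use_clause i j s : core (use_clause i j s) = update (set_clause_ptr j.+1) i (core s).
Proof. exact: core_upd_node. Qed.

Lemma nontabled_step s i nd A AL G' j C' th :
  inv s -> onth (core s) i = Some nd -> live (core s) i ->
  label nd = Call A AL :: G' -> ~ tabled P (pred_of A) -> clause_ptr nd <= j ->
  instance_of P s A j C' th ->
  let s' := register_child P i (Some j) (gsub th (calls [::] (body C') ++ G'))
              (use_clause i j s) in
  bounded s' -> inv s' /\ decreases s s'.
Proof.
move=> iv e lv l nt le_j ins s' bd; have [ok okt _ _] := iv.
have [_ ret _ its] := ok _ _ e.
have [okA _] : item_ok (core s) i (weight (label nd)) (Call A AL).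
  by apply: its; rewrite l mem_head.
have [/andP[j0 jP] oth le_b bodyP] := instance_ok ins okA.
have lt_w : weight (gsub th (calls [::] (body C') ++ G')) < weight (label nd).
  rewrite weight_gsub weight_cat l /weight /= ltn_add2r.
  by apply: weight_calls_le => // B /bodyP[_ d]; apply: rank_callee_nontabled.
apply: (child_step iv e lv (core_use_clause i j s) e) => //.
- by move=> _ [<-].
- by apply: remaining_clause; rewrite le_j.
- by case: ret; rewrite l // has_return_gsub has_return_calls.
- by rewrite l.
move=> y /mem_gsub[z + yz]; rewrite mem_cat => zin.
suff h : item_ok (rcons (update (set_clause_ptr j.+1) i (core s))
      (new_node i (Some j) (gsub th (calls [::] (body C') ++ G'))))
    (size (core s)) (weight (gsub th (calls [::] (body C') ++ G'))) z.
  by case: yz => -> //; apply: item_isub.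
case/orP: zin => [/mem_calls[B /bodyP[okB _] ->]|zG].
  by split=> //; exists [::].
apply: inherited_ok ok e _ _ (ltnW lt_w) => //.
by rewrite l inE zG orbT.
Qed.

(** Common to Cases 4.2 and 4.3. As [j] exceeds [node_ANC], adding [(i, A)] with number [j] keeps
    clause numbers increasing among variants. *)
Lemma tabled_step s i nd A AL G' j0 j C' th :
  inv s -> bounded s -> onth (core s) i = Some nd -> live (core s) i ->
  label nd = Call A AL :: G' -> node_ANC nd = Some j0 -> j0 < j ->
  clause_ptr nd <= j -> instance_of P s A j C' th ->
  let s' := register_child P i (Some j) (tabled_resolvent i A AL G' C' th)
              (use_clause i j s) in
  bounded s' -> inv s' /\ decreases s s'.
Proof.
move=> iv [bs _] e lv l a lt_j le_j ins s' bd; have [ok okt anc _] := iv.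
have [_ ret _ its] := ok _ _ e.
have [okA _] : item_ok (core s) i (weight (label nd)) (Call A AL).
  by apply: its; rewrite l mem_head.
have bA : tuple_bounded b (args A) by have := bs _ _ e; rewrite l => /andP[].
have [/andP[_ jP] oth le_b bodyP] := instance_ok ins okA.
set G := tabled_resolvent i A AL G' C' th in s' bd *.
set ns' := rcons (update (set_clause_ptr j.+1) i (core s)) (new_node i (Some j) G).
have [ks [ksE ksP pw] kj] := anc _ _ _ _ _ _ e a l.
have chain' : chain_ok ns' (size (core s)) ((i, A) :: AL) ((i, A, j) :: ks).
  split=> /=; first by rewrite ksE.
    move=> k; rewrite inE => /predU1P[->|/ksP[u ? ?]]; last first.
      by split=> //; apply: child_used e _ u.
    split=> //; last exact: keysP.
    apply: (@used_here _ _ (new_node i (Some j) G)) => //.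
    by rewrite onth_rcons size_update eqxx.
  rewrite pw andbT; apply/allP => k kks; apply/implyP => /eqP ek.
  by apply: leq_ltn_trans lt_j; apply: kj.
(* Applied to the extended chain, this gives [size AL < D]: the rank of [A] is positive, and the
   calls of the body have strictly smaller rank. *)
have lt_D := chain_size chain'.
have rank0 : 0 < call_rank A AL.
  by rewrite /call_rank; move: lt_D => /=; lia.
have ltB : {in body C', forall B, call_rank B ((i, A) :: AL) < call_rank A AL}.
  by move=> B /bodyP[_ d]; apply: rank_callee.
have lt_w : weight G < weight (label nd).
  rewrite /G /tabled_resolvent weight_cat weight_isub l /weight /= addnA ltn_add2r addn1.
  exact: weight_calls.
apply: (child_step iv e lv (core_use_clause i j s) e) => //.
- by move=> _ [<-].
- by apply: remaining_clause; rewrite le_j.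
- case: ret; rewrite l // => ret; rewrite /G /tabled_resolvent has_cat /=.
  by apply/orP; right.
- by rewrite l.
rewrite -/ns' => y; rewrite {1}/G /tabled_resolvent mem_cat inE => /orP[|/orP[/eqP->|yG]].
- case/mapP=> _ /mem_calls[B /bodyP[okB _] ->] ->; apply: item_isub => //.
  by split=> //; exists ((i, A, j) :: ks).
- split=> /=.
  + by rewrite -map_comp all_map; apply/allP => z _ /=.
  + by rewrite !size_map; apply: LP.
  exists (set_clause_ptr j.+1 nd) => //; apply: onth_rcons_old.
  by rewrite onth_update eqxx e.
apply: inherited_ok ok e _ _ (ltnW lt_w) => //.
by rewrite l inE yG orbT.
Qed.

Lemma control_lt ns i f nd nf : tree_ok ns ->
  onth ns i = Some nd -> onth ns f = Some nf -> parent nd = Some f ->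
  control_measure ns (Goto2 f) < control_measure ns (Goto3 i).
Proof.
move=> ok ei ef p; have [_ _ leW _] := ok _ _ ef.
have [/(_ _ p)[nf' [ef' lt _]] _ _ _] := ok _ _ ei.
move: ef' lt; rewrite ef => -[<-] lt /=.
by rewrite (node_weightE ei) (node_weightE ef); lia.
Qed.

Lemma anc_step s s' i nd A AL G' j ks :
  inv s -> ctrl s = Goto2 i -> onth (core s) i = Some nd -> live (core s) i ->
  label nd = Call A AL :: G' ->
  core s' = update (set_ANC (Some j)) i (core s) ->
  tables s' = tables s -> NEW s' = NEW s ->
  chain_ok (core s) i AL ks ->
  {in ks, forall e, akey e.1.2 = akey A -> e.2 <= j} ->
  (ctrl s' = Goto42 i /\ j = 0) \/ ctrl s' = Goto43 i ->
  inv s' /\ decreases s s'.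
Proof.
move=> [ok okt anc _] c e lv l ec et en ch kj c'.
have st : static (set_ANC (F := F) (Q := Q) (Some j)) by [].
have [ext ext'] := update_extends i (core s) st.
have lv' : live (core s') i by rewrite ec; apply: live_update => //; right.
have e' : onth (core s') i = Some (set_ANC (Some j) nd).
  by rewrite ec onth_update eqxx e.
have tm : tree_measure (core s') = tree_measure (core s).
  by rewrite ec /tree_measure map_update_id.
have w : node_weight (core s') i = node_weight (core s) i.
  by rewrite (node_weightE e) (node_weightE e').
split; last first.
  right; split; first by apply: global_measure_le; rewrite ?et ?en.
  by right; rewrite tm leqnn c; case: c' => [[-> _]|->] /=; rewrite w; lia.
split; rewrite ?et //; first by rewrite ec; apply: tree_ext ok.
  move=> i1 nd1 j1 A1 AL1 G1; rewrite ec onth_update; case: eqP => [->|_].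
    rewrite e /= => -[<-] /= [<-]; rewrite l => -[<- <- _].
    by exists ks => //; apply: chain_mono ch => h j'; apply: used_extends.
  move=> e1 a1 l1; have [ks1 ch1 kj1] := anc _ _ _ _ _ _ e1 a1 l1.
  by exists ks1 => //; apply: chain_mono ch1 => h j'; apply: used_extends.
case: c' => [[-> j0]|->] /=; exists (set_ANC (Some j) nd), A, AL, G';
  by split; rewrite //= j0.
Qed.

(** Numbers strictly decrease from one variant to the next outwards, so the closest variant carries
    the largest. *)
Lemma first_variant A AL1 h B AL2 ks :
  map fst ks = AL1 ++ (h, B) :: AL2 -> ~~ has (anc_variant A) AL1 ->
  anc_variant A (h, B) ->
  pairwise (fun e e' : nat * atom F Q * nat => (akey e.1.2 == akey e'.1.2) ==> (e'.2 < e.2)) ks ->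
  exists2 j, (h, B, j) \in ks &
    {in ks, forall e, akey e.1.2 = akey A -> e.2 <= j}.
Proof.
elim: AL1 ks => [|k AL1 IH] [|[k' j] ks] //= [-> ksE].
  move=> _ /[!anc_variantE] /= /eqP BA /andP[/allP pj _]; exists j; rewrite ?mem_head //.
  move=> e; rewrite inE => /predU1P[->//|/pj /= /implyP h' eA].
  by apply: ltnW; apply: h'; rewrite BA eA.
rewrite negb_or => /andP[nk /(IH ks ksE) h1] /h1 h2 /andP[_ /h2[j' jks max]].
exists j'; first by rewrite inE jks orbT.
move=> e; rewrite inE => /predU1P[->|/max //] /= ek.
by move: nk; rewrite anc_variantE ek eqxx.
Qed.

Lemma return_step s i nd Z G' :
  inv s -> at_node s Goto2 i nd (Return Q Z) G' ->
  let s' := goto (Goto3 i) (register_child P i None [::] (output Z s)) in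
  inv s' /\ decreases s s'.
Proof.
move=> iv [c e l] s'; have [ok okt anc _] := iv.
have [ec nl lv _] := current_ok iv (congr1 current c) e.
have lt0 : weight [::] < weight (label (norm nd)) by rewrite /= l.
(* No pointer moves here; an update by the identity fits the form expected by [child_ok]. *)
have updE : update id i (core s) = core s.
  by rewrite -[LHS]map_id map_update_id // map_id.
have [ok' anc' lv'] : [/\ tree_ok (core s'), anc_ok (core s') & live (core s') (size (core s))].
  have -> : core s' = rcons (update id i (core s)) (new_node i None [::]).
    by rewrite updE -[LHS]/(core (register_child P i None [::] (output Z s))) core_register.
  by apply: (child_ok ok anc lv ec) => //; left.
have core' : core s' = rcons (core s) (new_node i None [::]).
  by rewrite -[LHS]/(core (register_child P i None [::] (output Z s))) core_register.
have ec' : onth (core s') i = Some (norm nd) by rewrite core'; apply: onth_rcons_old.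
split.
  split=> //=; exists (norm nd); split=> // h j; rewrite core' => u.
  rewrite core' in ok'; have [nh eh cl] := lv _ _ (used_old ok (onth_lt ec) u).
  by exists nh => //; apply: onth_rcons_old.
right; split=> //; right; split.
  (* The empty child has potential 0, so the passage from [Goto2] to [Goto3] pays for the step. *)
  rewrite core' /tree_measure map_rcons sumn_rcons /potential /= muln0 addn0.
  exact: leqnn.
by rewrite c /= (node_weightE ec) (node_weightE ec') ltn_add2l.
Qed.

Lemma memo_step_ok s i nd h A U G' :
  inv s -> at_node s Goto2 i nd (MemoLook h A U) G' ->
  tables_bounded (tables (memo A U s)) ->
  [/\ tables_ok (table_info (tables (memo A U s))), core (memo A U s) = core s,
      memo A U s = s \/ global_measure (memo A U s) < global_measure s &
      exists2 ndh, onth (core s) h = Some ndh & weight (label nd) < weight (label ndh)].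
Proof.
move=> iv [c e l] bt; have [_ okt _ _] := iv.
have [_ _ _ [_ _ _ its]] := current_ok iv (congr1 current c) e.
have [oU sU hN] : item_ok (core s) i (weight (label nd)) (MemoLook h A U).
  by apply: its; rewrite /= l mem_head.
have okt' := memo_ok A oU sU okt.
split=> //; first by rewrite /core (memo_nodes A U s).1.
exact: memo_measure.
Qed.

Lemma step_ok s s' : inv s -> bounded s -> bounded s' -> step P s s' ->
  inv s' /\ decreases s s'.
Proof.
move=> iv bd bd' st; have [ok okt anc co] := iv.
have to3 i nd c : ctrl s = c -> current c = Some i -> onth (nodes s) i = Some nd ->
    (if c is Goto3 _ then false else true) ->
    control_ok (core s) (Goto3 i) /\
    control_measure (core s) (Goto3 i) < control_measure (core s) (ctrl s).
  move=> cE cur e n3; have [ec nl lv _] := current_ok iv (etrans (congr1 current cE) cur) e.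
  split; first by exists (norm nd).
  by rewrite cE; case: c cur n3 {cE} => //= _ [->]; rewrite // ltn_add2l.
have back i f nd nf x G' : backtrack s i f nd nf -> label nf = x :: G' ->
  [/\ control_ok (core s) (Goto2 f), control_ok (core s) (Goto3 f),
   control_measure (core s) (Goto2 f) < control_measure (core s) (ctrl s) &
   control_measure (core s) (Goto3 f) < control_measure (core s) (ctrl s)].
  move=> [c e p ef] l.
  have [ec nl lv _] := current_ok iv (congr1 current c) e.
  have lvf := live_parent ec p lv.
  have lt := control_lt ok ec (onth_core ef) p.
  have co_f : exists nd0, [/\ onth (core s) f = Some nd0, label nd0 <> [::] & live (core s) f].
    by exists (norm nf); split; rewrite //= ?l //; apply: onth_core.
  by rewrite c; split=> //; apply: leq_trans lt; rewrite /= ltnS leq_add2l.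
case: st bd'.
- by move=> i nd Z G' a _; apply: return_step a.
- move=> i nd h A U G' a lk [_ bt].
  have [okt' ec gm _] := memo_step_ok iv a bt; case: (a) => c e l.
  have [co3 cm3] := to3 _ _ _ c erefl e isT.
  split; first by split; rewrite ?[core _]ec.
  case: gm => [->|lt]; last by left.
  by right; split=> //; right; split.
- move=> i nd h A U G' J J' a lk fr bd'; case: (a) => c e l.
  have [ec nl lv _] := current_ok iv (congr1 current c) e.
  have bt : tables_bounded (tables (memo A U s)) by exact: create_bounded bd'.2.
  have [okt' eC gm [ndh eh lt_h]] := memo_step_ok iv a bt.
  have [ndh' [eh' lt_T oJ]] := lookup_ok okt' bt lk.
  move: eh'; rewrite eC eh => -[?]; subst ndh'.
  apply: (answer_step iv ec lv (l : label (norm nd) = _) _ _ eh) => //.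
  + rewrite -eC; exact: core_upd_node.
  + exact: ltnW.
  + by move=> y; apply: over_bind; apply: fresh_tuple_over fr oJ.
  by case: gm => [->//|lt]; apply: ltnW.
- move=> i nd A AL G' j C' th [c e l] nt [[cp _ _] _] ins bd'.
  have [ec nl lv _] := current_ok iv (congr1 current c) e.
  exact: nontabled_step iv ec lv l nt cp ins bd'.
- move=> i nd A AL G' [c e l] nt nc _.
  have [co3 cm3] := to3 _ _ _ c erefl e isT.
  exact: move_ok.
- move=> i nd A AL G' J J' [c e l] tab lk fr bd'.
  have [ec nl lv _] := current_ok iv (congr1 current c) e.
  have [nd' [ec' lt_T oJ]] := lookup_ok okt bd.2 lk.
  move: ec'; rewrite ec => -[?]; subst nd'.
  apply: (answer_step iv ec lv (l : label (norm nd) = _) _ _ ec) => //.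
  + exact: core_upd_node.
  by move=> y; apply: over_bind; apply: fresh_tuple_over fr oJ.
- move=> i nd A AL G' [c e l] *.
  have [co3 cm3] := to3 _ _ _ c erefl e isT.
  exact: move_ok.
- move=> i nd A AL G' [[c e l] tab _ _] a nv _.
  have [ec nl lv [_ _ _ its]] := current_ok iv (congr1 current c) e.
  have [_ [ks ch]] : item_ok (core s) i (weight (label nd)) (Call A AL).
    by apply: its; rewrite /= l mem_head.
  apply: (anc_step (j := 0) iv c ec lv l _ _ _ ch) => //; last by left.
    exact: core_upd_node.
  case: ch => ksE _ _ k kks ek; case/hasP: nv; exists k.1; last by rewrite anc_variantE ek.
  by rewrite -ksE map_f.
- move=> i nd A AL1 h B AL2 G' [[c e l] tab _ _] a nv va _.
  have [ec nl lv [_ _ _ its]] := current_ok iv (congr1 current c) e.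
  have [_ [ks ch]] : item_ok (core s) i (weight (label nd)) (Call A (AL1 ++ (h, B) :: AL2)).
    by apply: its; rewrite /= l mem_head.
  have [ksE ksP pw] := ch; have [j jks kj] := first_variant ksE nv va pw.
  (* By [live], the last clause fetched at [h], which [nodetype_update] reads off the clause
     pointer, is the clause [j] used by this branch. *)
  have [u _ _] := ksP _ jks; have [nh eh cl] := lv _ _ u.
  have [nh0 eh0] : exists2 nh0, onth (nodes s) h = Some nh0 & clause_ptr nh0 = j.+1.
    move: eh; rewrite /core onth_map; case: (onth _ h) => //= nh0 [nhE].
    by exists nh0; rewrite // -cl -nhE.
  move=> cl0; have ecN := core_nodetype (map fst AL1) i eh0; rewrite cl0 /= in ecN.
  have [etN enN] := tables_nodetype h (map fst AL1) i s.
  apply: (@anc_step _ (goto (Goto43 i) (nodetype_update h (map fst AL1) i s))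
    _ _ _ _ _ _ _ iv c ec lv l ecN etN enN ch kj).
  by right.
- move=> i nd A AL G' [[c e l] tab _ _] a _.
  have [ec nl lv _] := current_ok iv (congr1 current c) e.
  apply: move_ok => //; last by rewrite c /= ltn_add2l.
  by exists (norm nd), A, AL, G'.
- move=> i nd A AL G' j [[c e l] tab _ _] a _.
  have [ec nl lv _] := current_ok iv (congr1 current c) e.
  apply: move_ok => //; last by rewrite c /= ltn_add2l.
  by exists (norm nd), A, AL, G'; split=> //=; rewrite a.
- move=> i nd A AL G' j C' th [c e l] [[cp av _] _] ins bd'.
  have [ec nl lv _] := current_ok iv (congr1 current c) e.
  have a : node_ANC (norm nd) = Some 0.
    by move: co; rewrite c => -[nd' [A' [AL' [G0 [+ _ _ a]]]]]; rewrite ec => -[->].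
  (* Clause numbers start at 1, so every available clause lies above [node_ANC = 0]. *)
  have j0 : 0 < j by move: av; rewrite /available; case: (table_of s A) => // tb /andP[].
  exact: (tabled_step iv bd ec lv l a j0 cp ins bd').
- move=> i nd A AL G' [c e l] *.
  have [co3 cm3] := to3 _ _ _ c erefl e isT.
  exact: move_ok.
- move=> i nd A AL G' [c e l] *.
  have [co3 cm3] := to3 _ _ _ c erefl e isT.
  by apply: move_ok => //; apply: table_info_upd.
- move=> i nd A AL G' [c e l] nc it nw _.
  have [ec nl lv _] := current_ok iv (congr1 current c) e.
  set s1 := set_NEW _ _; set k := first_available s A in s1 *.
  have st : static (set_clause_ptr (F := F) (Q := Q) k) by [].
  have ec' : core s1 = update (set_clause_ptr k) i (core s) by apply: core_upd_node.
  have [ext ext'] := update_extends i (core s) st.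
  split; last first.
    (* Resetting the pointer may raise the tree measure; the fall of [NEW] outranks it. *)
    by left; rewrite /global_measure /= nw -[answers (tables s1)]/(answers (tables s)) addn0 addn1.
  split=> //; rewrite ?ec'; first exact: tree_ext ok.
    exact: anc_update.
  rewrite -[ctrl s1]/(ctrl s); move: co; rewrite c => -[nd' [A' [AL' [G0 [e' l' _ a']]]]].
  exists (set_clause_ptr k nd'), A', AL', G0; split=> //=.
    by rewrite onth_update eqxx e'.
  by apply: live_update => //; left.
- move=> i nd A AL G' j k C' th [c e l] a [[cp /andP[jk av] _] _] ins bd'.
  have [ec nl lv _] := current_ok iv (congr1 current c) e.
  exact: (tabled_step iv bd ec lv l a jk cp ins bd').
- move=> i nd A AL G' j [c e l] *.
  have [co3 cm3] := to3 _ _ _ c erefl e isT.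
  exact: move_ok.
- move=> i nd c e p _; apply: move_ok => //.
  by rewrite c /= addn1.
- move=> i f nd nf h A U G' bk l _; have [co2 co3 lt2 lt3] := back _ _ _ _ _ _ bk l.
  exact: move_ok.
- move=> i f nd nf A AL G' bk l *; have [co2 co3 lt2 lt3] := back _ _ _ _ _ _ bk l.
  exact: move_ok.
- move=> i f nd nf A AL G' bk l *; have [co2 co3 lt2 lt3] := back _ _ _ _ _ _ bk l.
  exact: move_ok.
- move=> i f nd nf A AL G' j bk l *; have [co2 co3 lt2 lt3] := back _ _ _ _ _ _ bk l.
  by apply: move_ok => //; apply: table_info_upd.
- move=> i f nd nf A AL G' j bk l *; have [co2 co3 lt2 lt3] := back _ _ _ _ _ _ bk l.
  by apply: move_ok => //; apply: core_upd_flags.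
Qed.
(** * Progress and termination *)

Lemma step_control s s' : step P s s' -> ctrl s <> ReturnedNO.
Proof.
case=> *; repeat match goal with
  | H : at_case4 _ _ _ _ _ _ _ |- _ => case: H => H _ _ _
  | H : at_node _ _ _ _ _ _ |- _ => case: H => + _ _
  | H : backtrack _ _ _ _ _ |- _ => case: H => + _ _ _
  end; congruence.
Qed.

Lemma extends_upd ns s k f :
  extends ns (nodes s) -> static f -> extends ns (nodes (upd_node k f s)).
Proof.
move=> h st; apply: extends_trans h _; exact: (update_extends k (nodes s) st).1.
Qed.

Lemma extends_foldr ns s l f :
  extends ns (nodes s) -> static f ->
  extends ns (nodes (foldr (fun k => upd_node k f) s l)).
Proof. by move=> h st; elim: l => //= k l IH; apply: extends_upd. Qed.

Lemma nodes_create G s : nodes (create_table P G s) = nodes s.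
Proof. by case: G => [|[A AL|h A U|Z] G] //=; case: ifP. Qed.

Lemma extends_register ns s i v G :
  extends ns (nodes s) -> extends ns (nodes (register_child P i v G s)).
Proof.
move=> h; have -> : nodes (register_child P i v G s) = rcons (nodes s) (new_node i v G).
  by rewrite /register_child /= /register nodes_create.
exact: extends_trans h (@extends_rcons _ _).
Qed.

Lemma step_extends s s' : step P s s' -> extends (nodes s) (nodes s').
Proof.
have refl := @extends_refl (nodes s).
have memo_ext A U : extends (nodes s) (nodes (memo A U s)) by rewrite (memo_nodes A U s).1.
case=> *; try exact: refl; try exact: memo_ext; try exact: extends_upd;
  try by apply: extends_register; rewrite // /advance /use_clause; apply: extends_upd.
rewrite /nodetype_update [nodes _]/=.
apply: extends_foldr => //; apply: extends_upd => //; apply: extends_upd.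
  exact: extends_foldr.
by move=> nd; case: ifP.
Qed.

Lemma fresh_shift s xs : exists M, fresh s (map (addn M) xs).
Proof.
pose l := flatten (map (goal_vars (F := F) (Q := Q) \o @label F Q) (nodes s)).
exists (sumn l).+1; apply/hasPn => _ /mapP[x _ ->]; apply/negP => /= xl.
have : (sumn l).+1 + x <= sumn l.
  by rewrite [leqRHS]sumnE (big_rem _ xl) //= leq_addr.
by lia.
Qed.

Lemma fresh_tuple_exists s (U : seq (term F)) : exists U', fresh_tuple s U U'.
Proof.
have [M fM] := fresh_shift s (tuple_vars U).
exists (map (tsub (ren F (addn M))) U).
have inj : {in tuple_vars U &, injective (addn M)} by move=> y z _ _; apply: addnI.
by split; [exists (addn M) | rewrite tuple_vars_ren].
Qed.

Lemma next_clauseP s nd A okj : no_clause P s nd A okj \/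
  exists j C' th, next_clause P s nd A okj j /\ instance_of P s A j C' th.
Proof.
have [[j0 c0]|nc] := pselect (exists j, candidate P s nd A okj j); last first.
  by left=> j c; apply: nc; exists j.
right; have ex : exists j, `[< candidate P s nd A okj j >].
  by exists j0; apply/asboolP.
case: (ex_minnP ex) => j /asboolP c min; exists j.
have [cp av [C [C' [s0 [eC fr un]]]]] := c.
(* [candidate] provides a mere unifier with a renamed clause; that same renaming has a most general
   one. *)
have [th m] := mgu_exists un; exists C', th; split; last by exists C.
by split=> // k lt_k /asboolP /min; rewrite leqNgt lt_k.
Qed.

Lemma split_first (p : pred (nat * atom F Q)) AL : has p AL ->
  exists AL1 k AL2, [/\ AL = AL1 ++ k :: AL2, ~~ has p AL1 & p k].
Proof.
elim: AL => //= k AL IH; case pk: (p k) => /=; first by exists [::], k, AL.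
by move=> /IH[AL1 [k' [AL2 [-> nh pk']]]]; exists (k :: AL1), k', AL2; rewrite /= pk.
Qed.

Lemma progress s : inv s -> ctrl s <> ReturnedNO -> exists s', step P s s'.
Proof.
move=> [ok _ _ co].
have node_at i nd : onth (core s) i = Some nd -> exists nd0,
    onth (nodes s) i = Some nd0 /\ nd = norm nd0.
  by rewrite /core onth_map; case: (onth _ i) => //= nd0 [<-]; exists nd0.
case c: (ctrl s) co => [i|i|i|i|] //= co _.
- case: co => _ [/node_at[nd [e ->]] /= nl _].
  case l: (label nd) nl => [|[A AL|h A U|Z] G'] // _; last first.
  + by eexists; apply: Case1; split; eauto.
  + have a : at_node s Goto2 i nd (MemoLook h A U) G' by [].
    case lk: (lookup (memo A U s) h A) => [J|].
      have [J' fr] := fresh_tuple_exists s J.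
      by eexists; apply: (Case2_answer _ a lk fr).
    by eexists; apply: (Case2_null _ a lk).
  have a : at_node s Goto2 i nd (Call A AL) G' by [].
  have [tab|nt] := pselect (tabled P (pred_of A)); last first.
    have [nc|[j [C' [th [nx ins]]]]] := next_clauseP s nd A predT.
      by eexists; apply: (Case3_none a nt nc).
    by eexists; apply: (Case3_clause a nt nx ins).
  case lk: (lookup s i A) => [J|].
    have [J' fr] := fresh_tuple_exists s J.
    by eexists; apply: (Case4_answer a tab lk fr).
  have [cm|ncm] := boolP (comp s A); first by eexists; apply: (Case4_complete a).
  have a4 : at_case4 P s i nd A AL G' by [].
  case anc: (node_ANC nd) => [[|j]|].
  + by eexists; apply: (Case4_to_42 a4).
  + by eexists; apply: (Case4_to_43 a4 anc).
  have [hv|nv] := boolP (has (anc_variant A) AL); last first.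
    by eexists; apply: (Case41_first a4).
  have [AL1 [[h B] [AL2 [ALE n1 vB]]]] := split_first hv; rewrite ALE in a4.
  by eexists; apply: (Case41_loop a4).
- case: co => _ [A [AL [G' [/node_at[nd [e ->]] /= l _ _]]]].
  have a : at_node s Goto42 i nd (Call A AL) G' by [].
  have [nc|[j [C' [th [nx ins]]]]] := next_clauseP s nd A (available s A); last first.
    by eexists; apply: (Case42_clause a nx ins).
  have [it|nit] := boolP (node_ITER nd); last by eexists; apply: (Case42_no_iter a).
  have [nw|nnw] := boolP (NEW s); first by eexists; apply: (Case422 a).
  by eexists; apply: (Case421 a).
- case: co => _ [A [AL [G' [/node_at[nd [e ->]] /= l _]]]].
  case anc: (node_ANC nd) => [j|] // _.
  have a : at_node s Goto43 i nd (Call A AL) G' by [].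
  have [nc|[k [C' [th [nx ins]]]]] :=
    next_clauseP s nd A (fun k => (j < k) && available s A k); last first.
    by eexists; apply: (Case43_clause a anc nx ins).
  by eexists; apply: (Case43_none a anc nc).
case: co => nd' [e' + _]; have [par _ _ _] := ok _ _ e'.
have [nd [e ndE]] := node_at _ _ e'; subst nd' => /= nl.
case p: (parent nd) => [f|]; last by eexists; apply: (Back_root _ c e p).
(* The current label is nonempty, so the parent starts neither with [Return] nor with nothing. *)
have [_ [/node_at[nf [ef ->]] _ [//|/= pr]]] := par f p.
have bk : backtrack s i f nd nf by [].
case l: (label nf) pr => [|[A AL|h A U|Z] G'] // _; last first.
  by eexists; apply: (CaseB1 _ bk l).
have [tab|nt] := pselect (tabled P (pred_of A)); last first.
  by eexists; apply: (CaseB2 bk l).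
case v: (via nd) => [j|]; last by eexists; apply: (CaseB3_answer bk l).
have [sus|nsus] := boolP (SUSP nf); first by eexists; apply: (CaseB3_susp bk l tab v).
by eexists; apply: (CaseB3_clause bk l tab v).
Qed.

Lemma terminates (r : nat -> state F Q) : inv (r 0) -> (forall n, bounded (r n)) ->
  (forall n, step P (r n) (r n.+1) \/
             (r n.+1 = r n /\ forall s, ~ step P (r n) s)) ->
  exists n, ctrl (r n) = ReturnedNO.
Proof.
move=> inv0 bd run.
have [//|nNO] := pselect (exists n, ctrl (r n) = ReturnedNO); exfalso.
have stepE n : inv (r n) -> step P (r n) (r n.+1).
  move=> iv; have [//|[_ stuck]] := run n.
  have [|s' st] := progress iv; last by case: (stuck s').
  by move=> c; apply: nNO; exists n.
have invE n : inv (r n).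
  by elim: n => // n IH; case: (step_ok IH (bd n) (bd n.+1) (stepE n IH)).
have dec n : decreases (r n) (r n.+1).
  by case: (step_ok (invE n) (bd n) (bd n.+1) (stepE n (invE n))).
(* Nested induction on strict upper bounds: when a component drops, the bounds of the lower ones are
   chosen afresh. *)
suff : forall g t c n, global_measure (r n) < g ->
    tree_measure (core (r n)) < t -> control_measure (core (r n)) (ctrl (r n)) < c -> False.
  by move=> h; apply: (h _ _ _ 0 (ltnSn _) (ltnSn _) (ltnSn _)).
elim=> // g IHg; elim=> // t IHt; elim=> // c IHc n lt_g lt_t lt_c.
case: (dec n) => [lt|[le_g [lt|[le_t lt]]]].
- by apply: (IHg _ _ n.+1 _ (ltnSn _) (ltnSn _)); lia.
- by apply: (IHt _ n.+1 _ _ (ltnSn _)); lia.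
- by apply: (IHc n.+1); lia.
Qed.

Definition init_goal (G0 : seq (atom F Q)) : goal F Q :=
  calls [::] G0 ++
  [:: Return Q (map (Var F) (undup (flatten (map (@atom_vars F Q) G0))))].

Lemma init_ok (G0 : seq (atom F Q)) :
  all atom_ok G0 -> weight (init_goal G0) <= W -> bounded (init P G0) ->
  inv (init P G0).
Proof.
move=> /allP okG leW [bg _].
pose root : node F Q := Node None None (init_goal G0) 0 1 false false false None.
have core0 : core (init P G0) = [:: root] by rewrite /init /register core_create.
have its x : x \in init_goal G0 -> item_ok [:: root] 0 (weight (init_goal G0)) x.
  rewrite mem_cat inE => /orP[/mem_calls[A /okG okA ->]|/eqP-> //].
  by split=> //; exists [::].
have root0 i nd : onth [:: root] i = Some nd -> i = 0 /\ nd = root.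
  by case: i => [[<-]//|i]; case: i.
have ret : has is_return (init_goal G0) by rewrite has_return_calls.
have notup i h j : ~ used [:: root] i h j.
  by case=> [i' nd h' j' /root0[_ ->]|i' nd f h' j' /root0[_ ->]].
have kG A AL G' : init_goal G0 = Call A AL :: G' -> akey A \in keys.
  move=> GE; have : subgoals_bounded b (init_goal G0) by apply: (bg 0 root); rewrite core0.
  rewrite GE => /andP[bA _].
  by apply: keysP => //; have [] := its (Call A AL); rewrite ?GE ?mem_head.
have ok0 : tables_ok [::] by [].
pose s0 := set_nodes [:: root] (State [::] [::] false [::] (Goto2 0)).
have [okt _] := create_table_ok (s := s0) ok0 kG.
split; rewrite ?core0 //.
- move=> i nd /root0[-> ->]; split=> //; first by right.
- by move=> i nd j A AL G' /root0[_ ->].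
have -> : ctrl (init P G0) = Goto2 0.
  rewrite /init /register; case: (calls _ _ ++ _) => [|[A AL|h A U|Z] G] //=.
  by case: ifP.
exists root; split=> //; first by move=> /= G00; rewrite G00 in ret.
by move=> h j /notup.
Qed.
End Machine.

Theorem theorem4p1 (F Q : eqType) (P : program F Q) (G0 : seq (atom F Q))
    (r : nat -> state F Q) :
  bounded_term_size P -> execution P G0 r ->
  (exists n, ctrl (r n) = ReturnedNO) /\ finite_set (TP_tree r).
Proof.
move=> [f fP] ex.
pose ts0 := flatten (map (@args F Q) G0).
(* The sum of the sizes stands in for their maximum, as [l] below does for the largest arity. *)
pose b := f (sumn (map (@tsize F) ts0)).
have [bt ba] : (forall N, TP_tree r N -> subgoals_bounded b N.2) /\
    (forall m, tables_bounded b (tables (r m))).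
  apply: (fP _ G0) => //; apply/allP => A AG; apply/allP => t tA.
  by apply: tsize_arg; apply/flattenP; exists (args A); rewrite ?map_f.
have [r0 run] := ex.
pose atoms := G0 ++ flatten [seq head C :: body C | C <- P].
pose Qs := map (@pred_of F Q) atoms.
pose Fs := flatten (map (@symbols F) (flatten (map (@args F Q) atoms))).
pose l := sumn (map snd Qs).
have okA A : A \in atoms -> atom_ok Fs Qs A.
  move=> Aa; rewrite /atom_ok map_f //=; apply/allP => t tA.
  apply: over_symbols => g gt; apply/flattenP; exists (symbols t) => //.
  by apply: map_f; apply/flattenP; exists (args A); rewrite ?map_f.
have arity A : atom_ok Fs Qs A -> size (args A) <= l.
  move=> /andP[pA _]; rewrite -[size _]/(pred_of A).2 /l sumnE big_map.
  by rewrite (big_rem _ pA) /= leq_addr.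
pose keys := [seq (q, U) | q <- Qs, U <- canons_upto Fs b l].
have keysP A : atom_ok Fs Qs A -> tuple_bounded b (args A) -> akey A \in keys.
  move=> okA' bA; apply/allpairsP; exists (akey A); split=> //=.
    by case/andP: okA'.
  by apply: mem_canons_upto => //; [apply: arity | case/andP: okA'].
have LP A : atom_ok Fs Qs A -> tuple_bounded b (args A) -> size (atom_vars A) <= l * b.
  by move=> /arity le_l /size_tuple_vars h; rewrite (leq_trans h) // leq_mul2r le_l orbT.
have P_ok : {in P, forall C, atom_ok Fs Qs (head C) /\ all (atom_ok Fs Qs) (body C)}.
  move=> C CP; have sub A : A \in head C :: body C -> atom_ok Fs Qs A.
    move=> inC; apply: okA; rewrite mem_cat; apply/orP; right; apply/flattenP.
    by exists (head C :: body C) => //; apply: map_f.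
  by split; [apply: sub; rewrite mem_head | apply/allP => A inC; apply: sub; rewrite inE inC orbT].
have bd n : bounded b (r n).
  split=> // i nd; rewrite /core onth_map; case e: (onth _ i) => [nd0|] //= [<-].
  by apply: (bt (i, parent nd0, label nd0)); exists n, nd0.
(* [W] is the weight of the root label, the heaviest in the tree. *)
have inv0 : inv P Fs Qs (l * b) (weight P keys (init_goal G0)) keys (r 0).
  rewrite r0; apply: (init_ok (b := b)) => //; last by rewrite -r0.
  by apply/allP => A AG; apply: okA; rewrite mem_cat AG.
have [N cN] := terminates P_ok keysP LP inv0 bd run.
split; first by exists N.
(* No step leaves [ReturnedNO]. As nodes are never removed or relabelled, every node ever registered
   is then already present in [r N]. *)
have stop m : r (N + m) = r N.
  elim: m => [|m IH]; first by rewrite addn0.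
  by rewrite addnS; case: (run (N + m)) => [/step_control|[-> _]]; rewrite IH.
have ext n m : extends (nodes (r n)) (nodes (r (n + m))).
  elim: m => [|m IH]; first by rewrite addn0; apply: extends_refl.
  rewrite addnS; apply: extends_trans IH _.
  by case: (run (n + m)) => [/step_extends|[-> _]] //; apply: extends_refl.
pose entry i := if onth (nodes (r N)) i is Some nd then (i, parent nd, label nd)
                else (i, None, [::]).
apply: sub_finite_set (finite_seq (map entry (iota 0 (size (nodes (r N)))))).
move=> x [n [nd [e ->]]] /=.
have [nd' [e' p _ g]] : exists nd', [/\ onth (nodes (r N)) x.1.1 = Some nd',
    parent nd' = parent nd, via nd' = via nd & label nd' = label nd].
  by have := ext n N _ _ e; rewrite addnC stop.
apply/mapP; exists x.1.1; first by rewrite mem_iota (onth_lt e').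
by rewrite /entry e' p g.
Qed.
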